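(* Let $C_1,\ldots,C_m\subseteq\mathcal{E}$ be closed convex sets with $C:=\bigcap_{i=1}^m C_i\neq\emptyset$. Let $\{x^k\}$ be a sequence generated by one of the four algorithms MPA, POCSA (in particular, CPA), MM (in particular, MDPA) and AWPA. Then the following hold. (i) $\{x^k\}$ satisfies: (1) for every $c\in C$, $\|x^{k+1}-c\|\le\|x^k-c\|$ for all $k$; and (2) there exist a positive integer $\ell$ and a nonnegative sequence $\{a_k\}$ with $\sum_{k=0}^\infty a_k=\infty$ such that $\mathrm{dist}^2(x^k,C)\ge\mathrm{dist}^2(x^{k+\ell},C)+a_k\max_{1\le i\le m}\mathrm{dist}^2(x^k,C_i)$ for all $k$. In particular, if $\Phi$ is a strict consistent error bound function for $C_1,\ldots,C_m$ and $\Phi^\spadesuit_{\widehat\kappa}$ is its inverse smoothing function with $\widehat\kappa=\|x^0\|+2\,\mathrm{dist}(0,C)$, then the convergence of $\{x^k\}$ is either finite (there is $\bar k$ with $x^k=x^{\bar k}\in C$ for all $k\ge\bar k$), or the following rate holds (the inequalities being understood to include that the right-hand sides are well defined). For MPA, MM (in particular, MDPA) and AWPA, for some indices $m(k)\in M(k)$, $$\mathrm{dist}(x^k,C)\le\sqrt{(\Phi^\spadesuit_{\widehat\kappa})^{-1}\Big(\Phi^\spadesuit_{\widehat\kappa}\big(\mathrm{dist}^2(x^0,C)\big)-\sum_{i=0}^{k-2}\mu_{m(i)}^i\Big)}\qquad\forall\,k\ge2.$$ For POCSA (in particular, CPA), $$\mathrm{dist}(x^k,C)\le\sqrt{(\Phi^\spadesuit_{\widehat\kappa})^{-1}\Big(\Phi^\spadesuit_{\widehat\kappa}\big(\mathrm{dist}^2(x^0,C)\big)-c\,\big(k-m-(k\bmod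 m)\big)/m\Big)}\qquad\forall\,k\ge2m,$$ where $c=\min\big(\frac{\epsilon^2}{m},\frac{\epsilon^2}{(2-\epsilon)^2m}\big)$ and $\epsilon\in(0,1)$ is the constant in the definition of POCSA. (ii) Suppose that $C_1,\ldots,C_m$ satisfy a H\''olderian error bound. Then $\{x^k\}$ converges to some point in $C$ at least with a sublinear rate $O(k^{-p})$ for some $p>0$, i.e. $\mathrm{dist}(x^k,C)=O(k^{-p})$. In particular, if the H\''olderian error bound is uniform with exponent $\gamma\in(0,1]$, then there exist $M>0$ and $\theta\in(0,1)$ such that for any $k\ge2m$ ($k\ge2$ for MPA, MDPA and AWPA), $$\mathrm{dist}(x^k,C)\le\begin{cases}M\,k^{-\frac{1}{2(\gamma^{-1}-1)}}&\text{if }\gamma\in(0,1),\\ M\,\theta^k&\text{if }\gamma=1.\end{cases}$$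
   Context: $\mathcal{E}$ is a finite-dimensional real vector space with norm $\|\cdot\|$ induced by an inner product; for a nonempty closed convex set $D$, $\mathrm{dist}(x,D)=\min_{y\in D}\|x-y\|$ and $P_D$ is the orthogonal projection onto $D$. ''Monotone increasing'' means strictly increasing. Algorithms. All are instances, from a given $x^0\in\mathcal{E}$, of $$x^{k+1}=\sum_{i=1}^m\lambda_i^k\big[(1-\alpha_i^k)x^k+\alpha_i^kP_{C_i}(x^k)\big],\quad \alpha_i^k\in[0,2),\ \lambda_i^k\ge0,\ \sum_i\lambda_i^k=1.$$ - MPA (mean projection algorithm): $\alpha_i^k=1$ and $\lambda_i^k=\nu_i>0$ for all $i,k$, with $\sum_i\nu_i=1$: $x^{k+1}=\sum_i\nu_iP_{C_i}(x^k)$. - POCSA (projections onto convex sets algorithm): with $t(k):=(k\bmod m)+1$ and a fixed $\epsilon\in(0,1)$, $x^{k+1}=(1-\alpha^k_{t(k)})x^k+\alpha^k_{t(k)}P_{C_{t(k)}}(x^k)$ where $\epsilon\le\alpha^k_{t(k)}\le2-\epsilon$ (that is, $\lambda^k_{t(k)}=1$, the other $\lambda_i^k$ are $0$, and the other $\alpha_i^k$ are irrelevant). CPA (cyclic projection algorithm) is the case $\alpha^k_{t(k)}\equiv1$. - MM (Motzkin's method): for a fixed $\lambda\in(0,2)$ and any $i(k)\in\mathop{\mathrm{Arg\,max}}_{1\le i\le m}\mathrm{dist}(x^k,C_i)$, $x^{k+1}=(1-\lambda)x^k+\lambda P_{C_{i(k)}}(x^k)$ ($\lambda^k_{i(k)}=1$,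 $\alpha^k_{i(k)}=\lambda$, other $\lambda_i^k=0$). MDPA (maximum distance projection algorithm) is the case $\lambda=1$. - AWPA (adaptive weighted projection algorithm): $f:[0,\infty)\to[0,\infty)$ is monotone increasing with $f(0)=0$, $d_i^k:=\mathrm{dist}(x^k,C_i)$, $\alpha_i^k=1$, $\lambda_i^k=\frac{f(d_i^k)}{f(d_1^k)+\cdots+f(d_m^k)}$ if at least one $d_i^k$ is nonzero, and $\lambda_i^k=1/m$ for all $i$ if $d_i^k=0$ for all $i$; so $x^{k+1}=\sum_i\lambda_i^kP_{C_i}(x^k)$. Notation: $M(k):=\mathop{\mathrm{Arg\,max}}_{1\le i\le m}\mathrm{dist}(x^k,C_i)$ (set of maximizing indices) and $\mu_i^k:=\alpha_i^k\lambda_i^k\big(2-\sum_{j=1}^m\alpha_j^k\lambda_j^k\big)$. A function $\Phi:[0,\infty)\times[0,\infty)\to[0,\infty)$ is a consistent error bound function for $C_1,\ldots,C_m$ if: (i) $\mathrm{dist}(x,C)\le\Phi\big(\max_{1\le i\le m}\mathrm{dist}(x,C_i),\|x\|\big)$ for all $x\in\mathcal{E}$; (ii) for every fixed $b\ge 0$, $\Phi(\cdot,b)$ is monotone nondecreasing on $[0,\infty)$, right-continuous at $0$, and $\Phi(0,b)=0$; (iii) for every fixed $a\ge0$, $\Phi(a,\cdot)$ is monotone nondecreasing on $[0,\infty)$. It is strict if in addition $\Phi(\cdot,b)$ is monotone increasing on $[0,\infty)$ for every $b>0$. For a monotone increasing $f:[0,\infty)\to[0,\infty)$, the generalized inverse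 is $f^-(s):=\inf\{t\ge0: f(t)\ge s\}$ for $0\le s<\sup f$. For strict $\Phi$ and $\kappa>0$, set $\phi_{\kappa,\Phi}(t):=(\Phi(\sqrt t,\kappa))^2$, $t\ge0$. The inverse smoothing function is $\Phi^\spadesuit_\kappa(t):=\int_\delta^t\frac{1}{\phi_{\kappa,\Phi}^-(s)}\,ds$ for $t\in(0,\sup\phi_{\kappa,\Phi})$, where $\delta\in(0,\sup\phi_{\kappa,\Phi})$ is some fixed (arbitrary) number. It is strictly increasing and continuous, and $(\Phi^\spadesuit_\kappa)^{-1}$ denotes its inverse, defined on its range. (If $\widehat\kappa=0$ then $x^0=0\in C$ and the convergence is finite.) $C_1,\ldots,C_m$ satisfy a H\''olderian error bound if for every bounded set $B\subseteq\mathcal{E}$ there exist $\theta_B>0$ and an exponent $\gamma_B\in(0,1]$ such that $\mathrm{dist}(x,C)\le\theta_B\max_{1\le i\le m}\mathrm{dist}(x,C_i)^{\gamma_B}$ for all $x\in B$. If the same exponent $\gamma_B=\gamma\in(0,1]$ can be taken for all $B$, the bound is uniform (with exponent $\gamma$). *)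

(* Defs.v *)
From HB Require Import structures.
From mathcomp Require Import all_boot all_order all_algebra.
From mathcomp Require Import sesquilinear.
From mathcomp Require Import all_classical all_reals all_analysis.

Set Implicit Arguments.
Unset Strict Implicit.
Unset Printing Implicit Defensive.

Import Order.TTheory GRing.Theory Num.Theory.
Import numFieldNormedType.Exports.

Local Open Scope classical_set_scope.
Local Open Scope ring_scope.

Definition finite_dimensional (R : realType) (E : normedModType R) : Prop :=
  exists (n : nat) (e : 'I_n -> E),
    forall v, exists a : 'I_n -> R, v = \sum_i a i *: e i.

Definition norm_from_inner_product (R : realType) (E : normedModType R) : Prop :=
  exists ip : {dot E for idfun}, forall v : E, `|v| ^+ 2 = ip v v.

Section Distance.
Context {R : realType} {E : normedModType R}.

(* For D nonempty and closed in finite dimension, the infimum is a minimum. *)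
Definition dist (v : E) (D : set E) : R := inf [set `|v - y| | y in D].

(* The nearest point exists and is unique for D nonempty, closed and convex;
   the default 0 is then never used. *)
Definition proj (D : set E) (v : E) : E :=
  xget 0 [set p | D p /\ forall y, D y -> `|v - p| <= `|v - y|].

Context {m : nat} (C : 'I_m -> set E).

(* Distances are nonnegative, so starting the maximum at 0 is harmless as soon
   as 0 < m. *)
Definition maxdist (v : E) : R := \big[Num.max/0]_(i < m) dist v (C i).

Definition farthest (v : E) : set 'I_m :=
  [set i | forall j, dist v (C j) <= dist v (C i)].

End Distance.

Section Algorithms.
Context {R : realType} {E : normedModType R} {m : nat} (C : 'I_m -> set E).
Implicit Types (alpha lam : nat -> 'I_m -> R) (x : nat -> E).

Definition projection_algorithm alpha lam x : Prop :=
  [/\ forall k i, 0 <= alpha k i < 2,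
      forall k i, 0 <= lam k i,
      forall k, \sum_i lam k i = 1
    & forall k, x k.+1 =
        \sum_i lam k i *: ((1 - alpha k i) *: x k + alpha k i *: proj (C i) (x k))].

Definition MPA alpha lam x : Prop :=
  projection_algorithm alpha lam x /\
  exists nu : 'I_m -> R,
    [/\ forall i, 0 < nu i, \sum_i nu i = 1
      & forall k i, alpha k i = 1 /\ lam k i = nu i].

(* Indices are 0-based: the active index at step k is k %% m. The cyclic
   projection algorithm (CPA) is the case where the active alpha is 1. *)
Definition POCSA (eps : R) alpha lam x : Prop :=
  [/\ projection_algorithm alpha lam x, 0 < eps < 1
    & forall k (i : 'I_m),
        if (i : nat) == (k %% m)%N
        then lam k i = 1 /\ eps <= alpha k i <= 2 - eps
        else lam k i = 0].

Definition MM (lambda : R) alpha lam x : Prop :=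
  [/\ projection_algorithm alpha lam x, 0 < lambda < 2
    & forall k, exists2 i, farthest C (x k) i &
        [/\ alpha k i = lambda, lam k i = 1 & forall j, j != i -> lam k j = 0]].

Definition MDPA alpha lam x : Prop := MM 1 alpha lam x.

Definition AWPA (f : R -> R) alpha lam x : Prop :=
  [/\ projection_algorithm alpha lam x,
      [/\ forall t, 0 <= t -> 0 <= f t, f 0 = 0
        & forall s t, 0 <= s -> s < t -> f s < f t],
      forall k i, alpha k i = 1
    & forall k,
        ((exists i, dist (x k) (C i) != 0) ->
          forall i, lam k i =
            f (dist (x k) (C i)) / \sum_j f (dist (x k) (C j))) /\
        ((forall i, dist (x k) (C i) = 0) -> forall i, lam k i = m%:R^-1)].

Definition mu alpha lam (k : nat) (i : 'I_m) : R :=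
  alpha k i * lam k i * (2 - \sum_j alpha k j * lam k j).

End Algorithms.

Section ErrorBounds.
Context {R : realType} {E : normedModType R} {m : nat} (C : 'I_m -> set E).

(* Functions on [0, +oo[ are represented by functions on R; only their values
   at nonnegative arguments are constrained or used. *)
Definition consistent_error_bound (Phi : R -> R -> R) : Prop :=
  [/\ forall a b, 0 <= a -> 0 <= b -> 0 <= Phi a b,
      forall v, dist v (\bigcap_i C i) <= Phi (maxdist C v) `|v|,
      forall b, 0 <= b ->
        [/\ forall a a', 0 <= a -> a <= a' -> Phi a b <= Phi a' b,
            Phi a b @[a --> 0^'+] --> Phi 0 b
          & Phi 0 b = 0]
    & forall a, 0 <= a ->
        forall b b', 0 <= b -> b <= b' -> Phi a b <= Phi a b'].

Definition strict_consistent_error_bound (Phi : R -> R -> R) : Prop :=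
  consistent_error_bound Phi /\
  forall b, 0 < b -> forall a a', 0 <= a -> a < a' -> Phi a b < Phi a' b.

Definition hoelder_bound_on (B : set E) (theta gamma : R) : Prop :=
  forall v, B v -> dist v (\bigcap_i C i) <= theta * maxdist C v `^ gamma.

Definition hoelderian_error_bound : Prop :=
  forall B : set E, bounded_set B ->
    exists theta gamma,
      [/\ 0 < theta, 0 < gamma <= 1 & hoelder_bound_on B theta gamma].

Definition uniform_hoelderian_error_bound (gamma : R) : Prop :=
  0 < gamma <= 1 /\
  forall B : set E, bounded_set B ->
    exists2 theta, 0 < theta & hoelder_bound_on B theta gamma.

End ErrorBounds.

Section InverseSmoothing.
Context {R : realType}.

Definition gen_inv (f : R -> R) (s : R) : R := inf [set t | 0 <= t /\ s <= f t].

Definition phi (kappa : R) (Phi : R -> R -> R) (t : R) : R :=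
  Phi (Num.sqrt t) kappa ^+ 2.

Definition integral_from (f : R -> R) (a b : R) : R :=
  if a <= b then \int[lebesgue_measure]_(s in `[a, b]) f s
  else - \int[lebesgue_measure]_(s in `[b, a]) f s.

(* The open interval ]0, sup phi[, whose right end may be +oo. *)
Definition ism_dom (kappa : R) (Phi : R -> R -> R) : set R :=
  [set t | 0 < t /\
    (t%:E < ereal_sup [set (phi kappa Phi u)%:E | u in [set u : R | (0 <= u)%R]])%E].

Definition ism (kappa : R) (Phi : R -> R -> R) (delta t : R) : R :=
  integral_from (fun s => (gen_inv (phi kappa Phi) s)^-1) delta t.

Definition ism_range (kappa : R) (Phi : R -> R -> R) (delta : R) : set R :=
  ism kappa Phi delta @` ism_dom kappa Phi.

(* Meaningful on ism_range only. *)
Definition ism_inv (kappa : R) (Phi : R -> R -> R) (delta : R) : R -> R :=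
  'pinv_(fun=> 0) (ism_dom kappa Phi) (ism kappa Phi delta).

End InverseSmoothing.

Section Conclusions.
Context {R : realType} {E : normedModType R} {m : nat} (C : 'I_m -> set E).
Variable x : nat -> E.

Definition fejer_monotone (D : set E) : Prop :=
  forall c, D c -> forall k, `|x k.+1 - c| <= `|x k - c|.

Definition sufficient_decrease : Prop :=
  exists (l : nat) (a : nat -> R),
    [/\ (0 < l)%N, forall k, 0 <= a k,
        (\sum_(0 <= k <oo) (a k)%:E = +oo)%E
      & forall k, dist (x (k + l)%N) (\bigcap_i C i) ^+ 2
            + a k * \big[Num.max/0]_(i < m) dist (x k) (C i) ^+ 2
          <= dist (x k) (\bigcap_i C i) ^+ 2].

Definition finite_convergence (D : set E) : Prop :=
  exists kbar, forall k, (kbar <= k)%N -> x k = x kbar /\ D (x kbar).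

Definition kappa_hat : R := `|x 0%N| + 2 * dist 0 (\bigcap_i C i).

(* dist (x k) (\bigcap_i C i) is bounded by the square root of the inverse of
   the inverse smoothing function at
     (inverse smoothing function at dist^2 (x 0) (\bigcap_i C i)) - s,
   every function being evaluated inside its domain. *)
Definition smoothing_rate (Phi : R -> R -> R) (delta s : R) (k : nat) : Prop :=
  let d0 := dist (x 0%N) (\bigcap_i C i) ^+ 2 in
  let y := ism kappa_hat Phi delta d0 - s in
  [/\ ism_dom kappa_hat Phi d0, ism_range kappa_hat Phi delta y
    & dist (x k) (\bigcap_i C i) <= Num.sqrt (ism_inv kappa_hat Phi delta y)].

Definition uniform_hoelder_rate (gamma : R) (k0 : nat) : Prop :=
  exists M theta, [/\ 0 < M, 0 < theta < 1
    & forall k, (k0 <= k)%N ->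
        dist (x k) (\bigcap_i C i) <=
          if gamma < 1 then M * k%:R `^ (- (2 * (gamma^-1 - 1))^-1)
          else M * theta ^+ k].

End Conclusions.

(* Main.v *)
Require Import Defs.
From HB Require Import structures.
From mathcomp Require Import all_boot all_order all_algebra.
From mathcomp Require Import sesquilinear.
From mathcomp Require Import all_classical all_reals all_analysis.
From mathcomp Require Import measurable_realfun.
From mathcomp Require Import ring lra.

(** Every step of a relaxed projection method decreases squared distances to a
common point c of the sets: expanding the square of the norm of x_(k+1) - c and
using that v - P_D v is normal to D at P_D v, one gets
[|x_(k+1) - c|^2 <= |x_k - c|^2 - sum_i mu_i^k dist(x_k, C_i)^2]
([relaxed_projections_step]). Hence the sequence is Fejer monotone, and with c the
projection of x_k onto the intersection C, the gain bounds the decrease of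
b_k = dist(x_k, C)^2.

All four methods then satisfy the same inequality
b_(k+l) + a * maxdist(x_k)^2 <= b_k with constants l > 0 and a > 0
([uniform_decrease]). For MPA, MM and AWPA a farthest index gets a weight mu
bounded below, and l = 1. For POCSA one step sees a single set, so l = m: within a
cycle every set is visited, and the distance from x_k to C_i is at most the length
travelled before the visit plus the distance at the visit
([POCSA_uniform_decrease]).

An error bound turns this into a scalar recursion. With a strict consistent error
bound function, b_k <= phi(maxdist(x_k)^2), that is, gen_inv phi (b_k) <=
maxdist(x_k)^2, so that b decreases by at least a * gen_inv phi (b_k). The
inverse smoothing function is the primitive of 1 / gen_inv phi, a nonincreasing
function, so it decreases by at least a between b_k and b_(k+l) ([ism_step]).
Telescoping, and inverting this continuous increasing function, gives the rates
([smoothing_rate_of_decrease]). The norm of every iterate is at most kappa_hat by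
Fejer monotonicity, which is why the second argument of Phi can be frozen.

With a Hoelderian error bound of exponent gamma on a ball containing the sequence,
the recursion is b_(k+l) <= b_k (1 - c b_k^q) with q = 1 / gamma - 1
([hoelder_recursion]). For q = 0 it is geometric; for q > 0, the inequality
1 - t <= exp(-t) shows that b_k^(-q) grows by at least c q over l steps, which
gives b_k = O(k^(-1/q)). Finally, a Fejer monotone sequence whose distance to C tends
to 0 is a Cauchy sequence, and its limit is in C.

Both the existence of projections and this convergence rest on the completeness of
a finite-dimensional inner product space, obtained from an orthonormal family
([cauchy_sequence_cvg]). *)

Set Implicit Arguments.
Unset Strict Implicit.
Unset Printing Implicit Defensive.

Import Order.TTheory GRing.Theory Num.Theory.
Import numFieldNormedType.Exports.

Local Open Scope classical_set_scope.
Local Open Scope ring_scope.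

(** * Inner products and completeness in finite dimension *)

(** Cauchy-Schwarz with weights: after symmetrization, the difference of the two
sides is half the sum of w_i w_j (t_i - t_j)^2. It serves both for the convex
combination of projections and, with unit weights, for the length of a cycle. *)
Lemma sqr_sum_le (R : realFieldType) (I : finType) (P : pred I) (w t : I -> R) :
  (forall i, P i -> 0 <= w i) ->
  (\sum_(i | P i) w i * t i) ^+ 2 <=
    (\sum_(i | P i) w i) * \sum_(i | P i) w i * t i ^+ 2.
Proof.
move=> w0; rewrite expr2.
set W := \sum_(i | P i) w i; set T := \sum_(i | P i) w i * t i ^+ 2.
have -> : W * T = (W * T + T * W) / 2 by field.
rewrite !big_distrlr /= -big_split /= mulr_suml ler_sum // => i Pi.
rewrite -big_split /= mulr_suml ler_sum // => j Pj.
have := mulr_ge0 (mulr_ge0 (w0 _ Pi) (w0 _ Pj)) (sqr_ge0 (t i - t j)).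
nra.
Qed.

Section InnerProduct.
Context {R : realType} {E : normedModType R} (ip : {dot E for idfun}).
Context (ipE : forall v : E, `|v| ^+ 2 = ip v v).

Lemma ip_sym u v : ip u v = ip v u.
Proof. by rewrite hermC expr0 mul1r. Qed.

(** The bilinearity of [ip] is restated for the coercion of [{dot E for idfun}] to
functions: the generic lemmas on bilinear forms produce terms whose head is another
canonical projection, which later rewriting steps would not recognize. *)
Lemma ipDr u v w : ip u (v + w) = ip u v + ip u w.
Proof. exact: linearDr. Qed.

Lemma ipNr u v : ip u (- v) = - ip u v.
Proof. exact: linearNr. Qed.

Lemma ipBr u v w : ip u (v - w) = ip u v - ip u w.
Proof. by rewrite ipDr ipNr. Qed.

Lemma ipZr a u v : ip u (a *: v) = a * ip u v.
Proof. exact: linearZr. Qed.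

Lemma ipZl a u v : ip (a *: u) v = a * ip u v.
Proof. by rewrite ip_sym ipZr ip_sym. Qed.

Lemma ip_sumr (I : Type) (s : seq I) (F : I -> E) u :
  ip u (\sum_(i <- s) F i) = \sum_(i <- s) ip u (F i).
Proof. exact: linear_sumr. Qed.

Lemma ip_suml (I : Type) (s : seq I) (F : I -> E) u :
  ip (\sum_(i <- s) F i) u = \sum_(i <- s) ip (F i) u.
Proof. by rewrite ip_sym ip_sumr; apply: eq_bigr => i _; rewrite ip_sym. Qed.

Lemma sqr_normD u v : `|u + v| ^+ 2 = `|u| ^+ 2 + 2 * ip u v + `|v| ^+ 2.
Proof. rewrite !ipE hnormD /= expr0 mul1r; ring. Qed.

Lemma sqr_normB u v : `|u - v| ^+ 2 = `|u| ^+ 2 - 2 * ip u v + `|v| ^+ 2.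
Proof. by rewrite sqr_normD ipNr normrN mulrN. Qed.

(** The squared norm of v - <u, v> u, which is |v|^2 - <u, v>^2, is nonnegative. *)
Lemma ip_unit_le u v : `|u| = 1 -> `|ip u v| <= `|v|.
Proof.
move=> u1; rewrite -ler_sqr ?nnegrE // real_normK ?num_real //.
have := sqr_ge0 `|v - ip u v *: u|.
rewrite sqr_normB ipZr normrZ exprMn real_normK ?num_real //.
rewrite u1 (ip_sym v u); lra.
Qed.

Definition frame_expansion (s : seq E) (v : E) : Prop :=
  v = \sum_(u <- s) ip u v *: u.

Lemma frame_expansion_sum s (I : finType) (a : I -> R) (e : I -> E) :
  (forall i, frame_expansion s (e i)) ->
  frame_expansion s (\sum_i a i *: e i).
Proof.
move=> se; rewrite /frame_expansion.
under [RHS]eq_bigr do rewrite ip_sumr scaler_suml.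
rewrite exchange_big /=; apply: eq_bigr => i _.
rewrite {1}(se i) scaler_sumr; apply: eq_bigr => u _.
by rewrite ipZr scalerA.
Qed.

(** Orthonormality is encoded by unit norms and by the expansion of the members of
s themselves: this makes v |-> sum_u <u, v> u the orthogonal projection onto the
span of s, which is all that the induction step and completeness need. *)
Lemma gram_schmidt (l : seq E) : exists s : seq E,
  {in s, forall u, `|u| = 1} /\ {in s ++ l, forall v, frame_expansion s v}.
Proof.
elim: l => [|e l [s [s1 se]]]; first by exists [::].
(* p is the projection of e onto the span of s, and w is the new direction *)
pose p := \sum_(u <- s) ip u e *: u; pose w := e - p.
have {}se v : v \in s ++ l -> v = \sum_(u <- s) ip u v *: u by exact: se.
have [w0|w0] := eqVneq w 0.
  exists s; split => // v; rewrite mem_cat inE orbCA => /predU1P[->|].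
    by apply/eqP; rewrite -subr_eq0 -/p -/w w0.
  by rewrite -mem_cat => /se.
have orth u : u \in s -> ip u w = 0.
  move=> us; rewrite ipBr ip_sumr /=; apply/eqP; rewrite subr_eq0.
  have us' : u \in s ++ l by rewrite mem_cat us.
  rewrite [X in ip X e](se _ us') ip_suml; apply/eqP.
  by apply: eq_bigr => z _; rewrite linearZl ipZr mulrC (ip_sym u z).
have orth_sum v : ip w (\sum_(u <- s) ip u v *: u) = 0.
  rewrite ip_sumr big_seq big1 // => u us.
  by rewrite ipZr (ip_sym w) orth ?mulr0.
have we : ip w e = `|w| ^+ 2.
  by rewrite -[e in LHS](subrK p) -/w ipDr orth_sum addr0 ipE.
have nw : `|w| != 0 by rewrite normr_eq0.
pose q := `|w|^-1 *: w.
have qq v : ip q v *: q = (`|w| ^- 2 * ip w v) *: w.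
  by rewrite ipZl scalerA mulrAC -expr2 exprVn.
have old v : v \in s ++ l -> frame_expansion (q :: s) v.
  move=> vsl; rewrite /frame_expansion big_cons qq {2}(se v vsl).
  by rewrite orth_sum mulr0 scale0r add0r -se.
exists (q :: s); split.
- move=> u; rewrite inE => /predU1P[->|/s1//].
  by rewrite normrZ normfV normr_id mulVf.
move=> v; rewrite /= inE mem_cat inE => /or3P[/eqP->|vs|/predU1P[->|vl]].
- rewrite /frame_expansion big_cons big_seq big1 ?addr0.
    by rewrite -ipE normrZ normfV normr_id mulVf // expr1n scale1r.
  by move=> u us; rewrite ipZr orth // mulr0 scale0r.
- by apply: old; rewrite mem_cat vs.
- rewrite /frame_expansion big_cons qq we mulVf ?expf_neq0 // scale1r.
  by rewrite subrK.
- by apply: old; rewrite mem_cat vl orbT.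
Qed.

Definition cauchy_sequence (x : nat -> E) :=
  forall e, 0 < e -> exists N, forall n k, (N <= n)%N -> (N <= k)%N ->
    `|x n - x k| <= e.

(** The coordinates <u, x_n> over an orthonormal family are real Cauchy sequences. *)
Lemma cauchy_sequence_cvg (Efin : finite_dimensional E) (x : nat -> E) :
  cauchy_sequence x -> exists l : E, x n @[n --> \oo] --> l.
Proof.
move=> cx; have [n [e espan]] := Efin.
have [s [s1 se]] := gram_schmidt (codom e).
have {}se v : v = \sum_(u <- s) ip u v *: u.
  have [a ->] := espan v; apply: frame_expansion_sum => i.
  by apply: se; rewrite mem_cat codom_f orbT.
have coord u : u \in s -> cvgn (fun k => ip u (x k)).
  move=> us; apply/cauchy_cvgP/cauchy_exP => eps eps0.
  have e2 : 0 < eps / 2 by lra.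
  have [N xN] := cx _ e2.
  exists (ip u (x N)), N => // k /= Nk.
  rewrite /ball /= -ipBr (le_lt_trans (ip_unit_le _ (s1 _ us))) //.
  by rewrite (le_lt_trans (xN _ _ _ _)) //; lra.
have xE : x = fun k => \sum_(u <- s) ip u (x k) *: u by apply/funext => k.
exists (\sum_(u <- s) lim (ip u (x k) @[k --> \oo]) *: u); rewrite {1}xE.
under eq_fun do rewrite big_seq; rewrite big_seq.
apply: (@cvg_big E E +%R 0 (mem s) (@add_continuous E)) => u us.
by apply: cvgZr_tmp; exact: coord.
Qed.

End InnerProduct.

(** * Projection onto a closed convex set *)

Section Distance.
Context {R : realType} {E : normedModType R}.
Implicit Types (v y : E) (D : set E).

Let dist_has_lbound v D : has_lbound [set `|v - y| | y in D].
Proof. by exists 0 => _ [y _ <-]. Qed.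

Lemma dist_le v D y : D y -> dist v D <= `|v - y|.
Proof. by move=> Dy; apply: ge_inf; [exact: dist_has_lbound|exists y]. Qed.

Lemma dist_ge v D r : D !=set0 -> (forall y, D y -> r <= `|v - y|) -> r <= dist v D.
Proof.
move=> [y0 Dy0] rD; apply: lb_le_inf; first by exists `|v - y0|, y0.
by move=> _ [y /rD ry <-].
Qed.

Lemma dist_ge0 v D : 0 <= dist v D.
Proof.
have [->|/set0P D0] := eqVneq D set0; first by rewrite /dist image_set0 inf0.
by apply: dist_ge.
Qed.

Lemma dist_approx v D e : D !=set0 -> 0 < e ->
  exists2 y, D y & `|v - y| < dist v D + e.
Proof.
move=> [y0 Dy0] e0.
have [|_ [y Dy <-] ye] := @inf_adherent _ [set `|v - y| | y in D] e e0.
  by split; [exists `|v - y0|, y0|exact: dist_has_lbound].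
by exists y.
Qed.

Lemma dist_lipschitz u v D : D !=set0 ->
  dist u D <= `|u - v| + dist v D.
Proof.
move=> D0; rewrite -lerBlDl; apply: dist_ge => // y Dy.
rewrite lerBlDl (le_trans (dist_le u Dy)) // -[u - y](subrKA v).
exact: ler_normD.
Qed.

Lemma convex_setP D y z t : convex_set D -> D y -> D z -> 0 <= t -> t <= 1 ->
  D (t *: y + (1 - t) *: z).
Proof.
move=> cD Dy Dz t0 t1.
by have := cD y z (Itv01 t0 t1) (mem_set Dy) (mem_set Dz); rewrite inE.
Qed.

End Distance.

Section Projection.
Context {R : realType} {E : normedModType R} (ip : {dot E for idfun}).
Context (ipE : forall v : E, `|v| ^+ 2 = ip v v) (Efin : finite_dimensional E).
Implicit Types (v y : E) (D : set E).

(** Parallelogram identity: the midpoint of y and z is in D by convexity, so its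
distance to v is at least [dist v D], which bounds |y - z|. *)
Lemma near_minimizers_close v D y z d :
  convex_set D -> D y -> D z -> `|v - y| <= dist v D + d -> `|v - z| <= dist v D + d ->
  `|y - z| ^+ 2 <= 4 * (d * (2 * dist v D + d)).
Proof.
move=> cD Dy Dz yd zd.
have Dm : D (2^-1 *: y + (1 - 2^-1) *: z) by apply: convex_setP => //; lra.
have := dist_le v Dm.
have -> : v - (2^-1 *: y + (1 - 2^-1) *: z) = 2^-1 *: ((v - y) + (v - z)).
  have -> : 1 - 2^-1 = 2^-1 :> R by field.
  have {1}-> : v = 2^-1 *: (v + v).
    by rewrite -mulr2n -(scaler_nat _ v) scalerA mulVf ?scale1r ?pnatr_eq0.
  by rewrite -scalerDr -scalerBr opprD addrACA.
have -> : y - z = (v - z) - (v - y) by rewrite opprB [RHS]addrC subrKA.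
rewrite normrZ ger0_norm ?invr_ge0 // => m.
have d0 := dist_ge0 v D.
have : dist v D ^+ 2 <= (2^-1 * `|v - y + (v - z)|) ^+ 2.
  by rewrite ler_sqr ?nnegrE // (le_trans d0).
have : `|v - y| ^+ 2 <= (dist v D + d) ^+ 2.
  by rewrite ler_sqr ?nnegrE // (le_trans _ yd).
have : `|v - z| ^+ 2 <= (dist v D + d) ^+ 2.
  by rewrite ler_sqr ?nnegrE // (le_trans _ zd).
rewrite exprMn (sqr_normB ipE (v - z)) (sqr_normD ipE (v - y) (v - z)).
rewrite (ip_sym ip (v - z)); nra.
Qed.

Lemma dist_attained v D : D !=set0 -> closed D -> convex_set D ->
  exists2 p, D p & `|v - p| = dist v D.
Proof.
move=> D0 clD cD; set d := dist v D.
have d0 : 0 <= d := dist_ge0 v D.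
have inv0 n : 0 < n.+1%:R^-1 :> R by rewrite invr_gt0 ltr0n.
have [y yP] : {y : nat -> E & forall n, D (y n) /\ `|v - y n| < d + n.+1%:R^-1}.
  by apply: (@choice _ _ (fun n y => D y /\ `|v - y| < d + n.+1%:R^-1)) => n;
    have [y] := dist_approx v D0 (inv0 n); exists y.
have inv_small (e : R) : 0 < e ->
    exists N, forall n, (N <= n)%N -> n.+1%:R^-1 <= e :> R.
  move=> e0; exists (Num.truncn e^-1) => n Nn.
  rewrite invf_ple ?posrE ?ltr0n // (le_trans (ltW (truncnS_gt _))) //.
  by rewrite ler_nat.
(* With s <= 1 the bound 4 s (2 d + s) is at most 4 s (2 d + 1) <= e^2. *)
have cy : cauchy_sequence y.
  move=> e e0; have k0 : 0 < 4 * (2 * d + 1) by nra.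
  have [|N NP] := inv_small (Num.min 1 (e ^+ 2 / (4 * (2 * d + 1)))).
    by rewrite lt_min ltr01 divr_gt0 ?exprn_gt0.
  exists N => n k Nn Nk; have := NP N (leqnn N); rewrite le_min => /andP[s1 se].
  rewrite -ler_sqr ?nnegrE // ?(ltW e0) //; set s := N.+1%:R^-1 in s1 se.
  have near_s j : (N <= j)%N -> `|v - y j| <= d + s.
    move=> Nj; rewrite (le_trans (ltW (yP j).2)) // lerD2l lef_pV2 ?posrE ?ltr0n //.
    by rewrite ler_nat.
  have := near_minimizers_close cD (yP n).1 (yP k).1 (near_s _ Nn) (near_s _ Nk).
  have s0 : 0 < s by exact: inv0.
  move: se; rewrite ler_pdivlMr // -/d; nra.
have [p yp] := cauchy_sequence_cvg ipE Efin cy.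
have Dp : D p.
  by apply: (closed_cvg D clD _ _ yp); apply: nearW => n; exact: (yP n).1.
exists p => //; apply/eqP; rewrite eq_le dist_le // andbT.
apply/ler_addgt0Pr => e e0; have e2 : 0 < e / 2 by lra.
have [N NP] := inv_small _ e2.
have [n [Nn np]] : exists n, (N <= n)%N /\ `|p - y n| < e / 2.
  have /filter_ex[n] : \forall n \near \oo, (N <= n)%N /\ `|p - y n| < e / 2.
    by apply: filterI; [exists N|move/cvgrPdist_lt: yp; exact].
  by exists n.
have := NP _ Nn; have := (yP n).2; set q := n.+1%:R^-1.
have : `|v - p| <= `|v - y n| + `|p - y n|.
  by rewrite (distrC p) ler_distD.
lra.
Qed.

Lemma projP v D : D !=set0 -> closed D -> convex_set D ->
  D (Defs.proj D v) /\ `|v - Defs.proj D v| = dist v D.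
Proof.
move=> D0 clD cD; have [p Dp vp] := dist_attained v D0 clD cD.
rewrite /Defs.proj; case: xgetP => [q _ [Dq qmin]|/(_ p)]; last first.
  by case; split=> // y Dy; rewrite vp dist_le.
by split=> //; apply/eqP; rewrite eq_le dist_le // andbT dist_ge.
Qed.

(** The segment from the projection p to c stays in D, so moving by t along it
cannot bring v closer: 2 <v - p, c - p> <= t |c - p|^2 for t in ]0, 1]. *)
Lemma proj_variational v D c : closed D -> convex_set D -> D c ->
  ip (v - Defs.proj D v) (c - Defs.proj D v) <= 0.
Proof.
move=> clD cD Dc; have [|Dp vp] := projP v _ clD cD; first by exists c.
set p := Defs.proj D v in Dp vp *.
apply/ler_addgt0Pr => e e0; rewrite add0r.
set b := `|c - p| ^+ 2; have b0 : 0 <= b := sqr_ge0 _.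
(* small enough for t |c - p|^2 <= e *)
pose t := Num.min 1 (e / (b + 1)).
have t0 : 0 < t by rewrite lt_min ltr01 divr_gt0 //; lra.
have [t1 te] : t <= 1 /\ t * (b + 1) <= e.
  rewrite -ler_pdivlMr ?ltr_wpDl //.
  by apply/andP; rewrite -le_min.
have := dist_le v (convex_setP cD Dc Dp (ltW t0) t1); rewrite -vp.
have -> : v - (t *: c + (1 - t) *: p) = (v - p) - t *: (c - p).
  by rewrite scalerBl scale1r scalerBr !opprD !opprK (addrCA (- (t *: c))) !addrA.
move=> m.
have : `|v - p| ^+ 2 <= `|v - p - t *: (c - p)| ^+ 2 by rewrite ler_sqr ?nnegrE.
rewrite (sqr_normB ipE (v - p)) ipZr normrZ exprMn (ger0_norm (ltW t0)) -/b.
nra.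
Qed.

Lemma proj_ip_le v D c : closed D -> convex_set D -> D c ->
  ip (Defs.proj D v - v) (v - c) <= - dist v D ^+ 2.
Proof.
move=> clD cD Dc; have [|_ vp] := projP v _ clD cD; first by exists c.
have := proj_variational v clD cD Dc; rewrite -vp ipE; set p := Defs.proj D v.
have -> : ip (p - v) (v - c) = ip (v - p) (c - p) - ip (v - p) (v - p).
  rewrite -ipBr -[p - v]opprB (ip_sym ip) ipNr (ip_sym ip) -ipNr opprB.
  by congr (ip _ _); rewrite opprB addrA subrK.
lra.
Qed.

End Projection.

(** * One step of relaxed projections *)

Section ConvexIntersection.
Context {R : realType} {E : normedModType R} {m : nat} (C : 'I_m -> set E).

Lemma closed_bigcap_sets : (forall i, closed (C i)) -> closed (\bigcap_i C i).
Proof. by move=> clC; apply: closed_bigI. Qed.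

Lemma convex_bigcap_sets : (forall i, convex_set (C i)) -> convex_set (\bigcap_i C i).
Proof.
move=> cC y z t /set_mem Dy /set_mem Dz; apply/mem_set => i _.
by have := cC i y z t (mem_set (Dy i I)) (mem_set (Dz i I)); rewrite inE.
Qed.

Lemma maxdist_ge0 v : 0 <= maxdist C v.
Proof. by rewrite /maxdist bigmax_ge_id. Qed.

Lemma dist_le_maxdist v i : dist v (C i) <= maxdist C v.
Proof. exact: le_bigmax. Qed.

Lemma dist_farthest v i : farthest C v i -> dist v (C i) = maxdist C v.
Proof.
move=> vi; apply/eqP; rewrite eq_le dist_le_maxdist /=.
by apply: bigmax_le => [|j _]; [exact: dist_ge0|exact: vi].
Qed.

Lemma farthest_exists v : (0 < m)%N -> exists i, farthest C v i.
Proof.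
case: m C => // m' C' _.
have [i _ iP] := @Order.TotalTheory.arg_maxP _ _ _ ord0 xpredT
  (fun i => dist v (C' i)) isT.
by exists i => j; exact: iP.
Qed.

Lemma bigmax_sqr_dist v :
  \big[Num.max/0]_(i < m) dist v (C i) ^+ 2 = maxdist C v ^+ 2.
Proof.
apply/eqP; rewrite eq_le; apply/andP; split.
  by apply: bigmax_le => [|i _]; rewrite ?sqr_ge0 // ler_sqr ?nnegrE
    ?dist_ge0 ?maxdist_ge0 ?dist_le_maxdist.
have [m0|m_gt0] := posnP m; last first.
  by have [i /dist_farthest <-] := farthest_exists v m_gt0; exact: le_bigmax.
by rewrite /maxdist !big_pred0 ?expr0n // => i; have := ltn_ord i; rewrite {2}m0.
Qed.
End ConvexIntersection.

Section Step.
Context {R : realType} {E : normedModType R} (ip : {dot E for idfun}).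
Context (ipE : forall v : E, `|v| ^+ 2 = ip v v) (Efin : finite_dimensional E).
Context {m : nat} (C : 'I_m -> set E).
Context (Cclosed : forall i, closed (C i)) (Cconvex : forall i, convex_set (C i)).
Context (alpha lam : nat -> 'I_m -> R) (x : nat -> E).
Context (hx : projection_algorithm C alpha lam x).

(** With w_i = alpha_i lam_i, v_i = P_i x - x and W the sum of the w_i, the step is
x + sum_i w_i v_i. The cross terms are at most - w_i d_i^2 by [proj_ip_le], and the
square of the displacement is at most W sum_i w_i d_i^2, whence the factor 2 - W. *)
Lemma relaxed_projections_step c k : (\bigcap_i C i) c ->
  `|x k.+1 - c| ^+ 2 <=
    `|x k - c| ^+ 2 - \sum_i mu alpha lam k i * dist (x k) (C i) ^+ 2.
Proof.
move=> Cc; have [a_bd l_ge0 l_sum xE] := hx.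
pose w i := alpha k i * lam k i; pose v i := Defs.proj (C i) (x k) - x k.
have w_ge0 i : 0 <= w i by rewrite mulr_ge0 //; case/andP: (a_bd k i).
have vd i : `|v i| = dist (x k) (C i).
  have [|_ <-] := projP ipE Efin (x k) _ (@Cclosed i) (@Cconvex i);
    last by rewrite distrC.
  by exists c; exact: Cc.
have -> : x k.+1 - c = (x k - c) + \sum_i w i *: v i.
  rewrite xE addrAC; congr (_ - c).
  transitivity (\sum_i lam k i *: x k + \sum_i w i *: v i); last first.
    by rewrite -scaler_suml l_sum scale1r.
  rewrite -big_split /=.
  apply: eq_bigr => i _; rewrite /w mulrC -scalerA -scalerDr; congr (_ *: _).
  by rewrite scalerBl scale1r scalerBr addrAC -addrA.
rewrite (sqr_normD ipE) ip_sumr.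
have ip_le : \sum_i ip (x k - c) (w i *: v i) <= - \sum_i w i * dist (x k) (C i) ^+ 2.
  rewrite -sumrN; apply: ler_sum => i _; rewrite ipZr -mulrN ler_wpM2l //.
  by rewrite (ip_sym ip); apply: proj_ip_le => //; exact: Cc.
have sq_le : `|\sum_i w i *: v i| ^+ 2 <=
    (\sum_i w i) * \sum_i w i * dist (x k) (C i) ^+ 2.
  apply: le_trans (sqr_sum_le _ (fun i _ => w_ge0 i)).
  rewrite ler_sqr ?nnegrE //; last first.
    by apply: sumr_ge0 => i _; rewrite mulr_ge0 // dist_ge0.
  apply: le_trans (ler_norm_sum _ _ _) _; apply: ler_sum => i _.
  by rewrite normrZ ger0_norm // vd.
have -> : \sum_i mu alpha lam k i * dist (x k) (C i) ^+ 2 =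
    (2 - \sum_i w i) * \sum_i w i * dist (x k) (C i) ^+ 2.
  by rewrite mulr_sumr; apply: eq_bigr => i _; rewrite /mu [X in X * _]mulrC -mulrA.
lra.
Qed.

Lemma mu_ge0 k i : 0 <= mu alpha lam k i.
Proof.
have [a_bd l_ge0 l_sum _] := hx.
have a0 j : 0 <= alpha k j by case/andP: (a_bd k j).
rewrite /mu !mulr_ge0 // subr_ge0.
have <- : \sum_j 2 * lam k j = 2 by rewrite -mulr_sumr l_sum mulr1.
by apply: ler_sum => j _; rewrite ler_wpM2r //; case/andP: (a_bd k j) => _ /ltW.
Qed.

Lemma step_le c k i : (\bigcap_i C i) c ->
  `|x k.+1 - c| ^+ 2 + mu alpha lam k i * dist (x k) (C i) ^+ 2 <= `|x k - c| ^+ 2.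
Proof.
move=> /(relaxed_projections_step k); rewrite (bigD1 i) //=.
set s := \sum_(_ | _) _; suff : 0 <= s by lra.
by apply: sumr_ge0 => j _; rewrite mulr_ge0 ?mu_ge0 ?sqr_ge0.
Qed.

Context (m_gt0 : (0 < m)%N).

Lemma projection_algorithm_fejer : fejer_monotone x (\bigcap_i C i).
Proof.
move=> c Cc k; rewrite -ler_sqr ?nnegrE //.
pose i := Ordinal m_gt0; have := step_le k i Cc.
have := mulr_ge0 (mu_ge0 k i) (sqr_ge0 (dist (x k) (C i))); lra.
Qed.

Context (C0 : \bigcap_i C i !=set0).

Lemma step_dist_le k i :
  dist (x k.+1) (\bigcap_i C i) ^+ 2 + mu alpha lam k i * dist (x k) (C i) ^+ 2
    <= dist (x k) (\bigcap_i C i) ^+ 2.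
Proof.
have [|Dp <-] := projP ipE Efin (x k) C0 (closed_bigcap_sets Cclosed).
  exact: convex_bigcap_sets.
apply: le_trans (step_le k i Dp); rewrite lerD2r ler_sqr ?nnegrE ?dist_ge0 //.
exact: dist_le.
Qed.

End Step.

(** * Uniform decrease of the squared distance *)

Section UniformDecrease.
Context {R : realType} {E : normedModType R} (ip : {dot E for idfun}).
Context (ipE : forall v : E, `|v| ^+ 2 = ip v v) (Efin : finite_dimensional E).
Context {m : nat} (m_gt0 : (0 < m)%N) (C : 'I_m -> set E).
Context (Cclosed : forall i, closed (C i)) (Cconvex : forall i, convex_set (C i)).
Context (C0 : \bigcap_i C i !=set0).
Context (alpha lam : nat -> 'I_m -> R) (x : nat -> E).

(** Unlike in [sufficient_decrease], the coefficient a is independent of k; this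
holds for all four methods and is what the Hoelderian rates need. *)
Definition uniform_decrease (l : nat) (a : R) : Prop :=
  forall k, dist (x (k + l)%N) (\bigcap_i C i) ^+ 2 + a * maxdist C (x k) ^+ 2
    <= dist (x k) (\bigcap_i C i) ^+ 2.

Lemma uniform_decrease_of_mu a : projection_algorithm C alpha lam x ->
  (forall k, exists2 i, farthest C (x k) i & a <= mu alpha lam k i) ->
  uniform_decrease 1 a.
Proof.
move=> hx amu k; have [i /dist_farthest <- ai] := amu k.
rewrite addn1; have := step_dist_le ipE Efin Cclosed Cconvex hx C0 k i.
have := ler_wpM2r (sqr_ge0 (dist (x k) (C i))) ai; lra.
Qed.

Lemma MPA_uniform_decrease : MPA C alpha lam x ->
  exists2 a, 0 < a & uniform_decrease 1 a.
Proof.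
move=> [hx [nu [nu_gt0 nu1 nuE]]].
have [i0 _ nu_min] := @Order.TotalTheory.arg_minP _ _ _ (Ordinal m_gt0) xpredT nu isT.
exists (nu i0) => //; apply: uniform_decrease_of_mu => // k.
have [i ik] := farthest_exists C (x k) m_gt0; exists i => //.
rewrite /mu; have [-> ->] := nuE k i; rewrite mul1r.
under eq_bigr do rewrite (nuE _ _).1 (nuE _ _).2 mul1r.
have := nu_min i isT; rewrite nu1; lra.
Qed.

Lemma MM_uniform_decrease lambda : MM C lambda alpha lam x ->
  exists2 a, 0 < a & uniform_decrease 1 a.
Proof.
move=> [hx /andP[l0 l2] far]; exists (lambda * (2 - lambda)); first by nra.
apply: uniform_decrease_of_mu => // k; have [i ik [ai li lj]] := far k.
exists i => //; rewrite /mu (bigD1 i) //= ai li mulr1 big1 ?addr0 //.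
by move=> j /lj ->; rewrite mulr0.
Qed.

(** f is increasing, so the weight of a farthest set is the largest of m weights
with sum 1, hence at least 1 / m. *)
Lemma AWPA_uniform_decrease f : AWPA C f alpha lam x ->
  exists2 a, 0 < a & uniform_decrease 1 a.
Proof.
move=> [hx [f_ge0 f0 f_mono] a1 lamE]; have mR : 0 < m%:R :> R by rewrite ltr0n.
exists m%:R^-1; first by rewrite invr_gt0.
apply: uniform_decrease_of_mu => // k; have [_ _ lam1 _] := hx.
have [i ik] := farthest_exists C (x k) m_gt0; exists i => //.
rewrite /mu a1 mul1r; under eq_bigr do rewrite a1 mul1r.
rewrite lam1; suff : m%:R^-1 <= lam k i by lra.
have [lam_pos lam_zero] := lamE k.
have [d0|/existsNP[j /eqP dj]] := pselect (forall j, dist (x k) (C j) = 0).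
  by rewrite lam_zero.
rewrite lam_pos; last by exists j.
have f_le j' : f (dist (x k) (C j')) <= f (dist (x k) (C i)).
  have := ik j'; rewrite le_eqVlt => /predU1P[->//|/f_mono].
  by move=> /(_ (dist_ge0 _ _)) /ltW.
have fi_gt0 : 0 < f (dist (x k) (C i)).
  rewrite -f0 f_mono // (lt_le_trans _ (ik j)) //.
  by rewrite lt_neqAle eq_sym dj dist_ge0.
have sum_gt0 : 0 < \sum_j f (dist (x k) (C j)).
  rewrite (bigD1 i) //= ltr_pwDl // sumr_ge0 // => j' _.
  by rewrite f_ge0 // dist_ge0.
rewrite ler_pdivlMr // mulrC ler_pdivrMr // mulrC.
have -> : m%:R * f (dist (x k) (C i)) = \sum_(j < m) f (dist (x k) (C i)).
  by rewrite sumr_const card_ord mulr_natl.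
exact: ler_sum.
Qed.

End UniformDecrease.

Definition pocsa_rate (R : realType) (m : nat) (eps : R) : R :=
  Num.min (eps ^+ 2 / m%:R) (eps ^+ 2 / ((2 - eps) ^+ 2 * m%:R)).

Section CyclicDecrease.
Context {R : realType} {E : normedModType R} (ip : {dot E for idfun}).
Context (ipE : forall v : E, `|v| ^+ 2 = ip v v) (Efin : finite_dimensional E).
Context {m : nat} (m_gt0 : (0 < m)%N) (C : 'I_m -> set E).
Context (Cclosed : forall i, closed (C i)) (Cconvex : forall i, convex_set (C i)).
Context (C0 : \bigcap_i C i !=set0).
Context (alpha lam : nat -> 'I_m -> R) (x : nat -> E).

Lemma cyclic_visit k (i : 'I_m) : exists2 s, (s < m)%N & ((k + s) %% m = i)%N.
Proof.
exists ((i + (m - k %% m)) %% m)%N; first by rewrite ltn_mod.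
rewrite modnDmr -modnDml addnCA subnKC; last by rewrite ltnW // ltn_mod.
by rewrite modnDr modn_small.
Qed.

Lemma pocsa_rate_gt0 (eps : R) : 0 < eps < 1 -> 0 < pocsa_rate m eps.
Proof.
move=> /andP[e0 e1]; have mR : 0 < m%:R :> R by rewrite ltr0n.
by rewrite lt_min !divr_gt0 ?mulr_gt0 ?exprn_gt0 //; lra.
Qed.

(** The factor Num.max 1 a is the coefficient in [pocsa_dist_le] of a step with
relaxation a: the distance to the active set counts once at the visit, and a times,
as a displacement, before it. *)
Lemma pocsa_rate_le (eps a : R) : 0 < eps < 1 -> eps <= a <= 2 - eps ->
  pocsa_rate m eps * m%:R * Num.max 1 a ^+ 2 <= a * (2 - a).
Proof.
move=> /andP[e0 e1] /andP[ea ae]; have mR : 0 < m%:R :> R by rewrite ltr0n.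
have r2 : pocsa_rate m eps * m%:R <= (eps / (2 - eps)) ^+ 2.
  rewrite -ler_pdivlMr // /pocsa_rate ge_min exprMn exprVn; apply/orP; right.
  by rewrite invfM mulrA.
apply: le_trans (ler_wpM2r (sqr_ge0 _) r2) _; rewrite -exprMn.
have q2 : 0 < 2 - eps by lra.
set q := eps / (2 - eps); have qE : q * (2 - eps) = eps by rewrite divfK // gt_eqF.
have q0 : 0 < q by rewrite divr_gt0.
(* Since eps < 1 < 2 - eps, the second term of the minimum in pocsa_rate is the
   smaller one, and q is the square root of m times it. *)
have q1 : q <= eps by nra.
case: (leP 1 a) => a1; last by rewrite mulr1; nra.
have qa : q * a <= eps by have := ler_wpM2l (ltW q0) ae; lra.
have qa0 : 0 <= q * a by rewrite mulr_ge0 ?(ltW q0) //; lra.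
have : (q * a) ^+ 2 <= eps * (q * a) by rewrite expr2 ler_wpM2r.
have : eps * (q * a) <= eps * a by rewrite ler_pM2l // ler_piMl //; lra.
have : eps * a <= a * (2 - a) by rewrite mulrC ler_wpM2l //; lra.
lra.
Qed.

Context (eps : R) (hx : POCSA C eps alpha lam x).

Definition active (j : nat) : 'I_m := Ordinal (ltn_pmod j m_gt0).

Let a j := alpha j (active j).
Let d j := dist (x j) (C (active j)).

Let a_bd j : eps <= a j <= 2 - eps.
Proof. by have [_ _ /(_ j (active j))] := hx; rewrite eqxx => -[]. Qed.

Let lam_active j : lam j (active j) = 1.
Proof. by have [_ _ /(_ j (active j))] := hx; rewrite eqxx => -[]. Qed.

Let lam_idle j i : i != active j -> lam j i = 0.
Proof.
move=> ij; have [_ _ /(_ j i)] := hx; case: eqP => // ijE.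
by case/eqP: ij; apply/val_inj.
Qed.

Lemma pocsa_mu j : mu alpha lam j (active j) = a j * (2 - a j).
Proof.
rewrite /mu (bigD1 (active j)) //= big1 ?addr0; first by rewrite lam_active !mulr1.
by move=> i /lam_idle ->; rewrite mulr0.
Qed.

Let Ci0 i : C i !=set0.
Proof. by have [c Cc] := C0; exists c; exact: Cc. Qed.

Let a_ge0 j : 0 <= a j.
Proof. by have [_ /andP[e0 _] _] := hx; have /andP[ea _] := a_bd j; lra. Qed.

Lemma pocsa_displacement j : `|x j.+1 - x j| <= a j * d j.
Proof.
have [[_ _ _ ->] _ _] := hx; rewrite (bigD1 (active j)) //= big1 ?addr0; last first.
  by move=> i /lam_idle ->; rewrite scale0r.
have [_ dE] := projP ipE Efin (x j) (Ci0 (active j)) (@Cclosed _) (@Cconvex _).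
rewrite /d -dE lam_active scale1r -/(a j) scalerBl scale1r.
rewrite addrAC (addrC (x j)) addrK addrC -scalerBr.
by rewrite normrZ ger0_norm // distrC.
Qed.

Lemma pocsa_drift k n : `|x k - x (k + n)%N| <= \sum_(t < n) a (k + t)%N * d (k + t)%N.
Proof.
elim: n => [|n IH]; first by rewrite addn0 subrr normr0 big_ord0.
rewrite big_ord_recr /= addnS -[x k - _](subrKA (x (k + n)%N)).
apply: le_trans (ler_normD _ _) _; apply: lerD => //.
by rewrite distrC; exact: pocsa_displacement.
Qed.

Lemma pocsa_window_decrease c k n : (\bigcap_i C i) c ->
  `|x (k + n)%N - c| ^+ 2
    + \sum_(t < n) a (k + t)%N * (2 - a (k + t)%N) * d (k + t)%N ^+ 2
  <= `|x k - c| ^+ 2.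
Proof.
move=> Cc; have [hp _ _] := hx.
elim: n => [|n IH]; first by rewrite addn0 big_ord0 addr0.
rewrite big_ord_recr /= addnS.
have := step_le ipE Efin Cclosed Cconvex hp (k + n) (active (k + n)) Cc.
by rewrite pocsa_mu -/(d _); lra.
Qed.

(** If C_i is visited at step k + s, go from x_k to x_(k + s) and then project: the
path of s displacements is completed by one distance, and the remaining terms of
the sum are nonnegative. *)
Lemma pocsa_dist_le k i :
  dist (x k) (C i) <= \sum_(t < m) Num.max 1 (a (k + t)%N) * d (k + t)%N.
Proof.
have [s sm si] := cyclic_visit k i.
have -> : i = active (k + s) by apply/val_inj.
apply: le_trans (dist_lipschitz _ (x (k + s)%N) (Ci0 _)) _; rewrite -/(d _).
have -> : \sum_(t < m) Num.max 1 (a (k + t)%N) * d (k + t)%N =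
   \sum_(0 <= t < m) Num.max 1 (a (k + t)%N) * d (k + t)%N by rewrite big_mkord.
have term_ge0 t : 0 <= Num.max 1 (a (k + t)%N) * d (k + t)%N.
  by rewrite mulr_ge0 ?dist_ge0 // le_max ler01.
rewrite (@big_cat_nat _ _ _ s.+1) //= big_nat_recr //= -addrA.
apply: lerD.
  rewrite big_mkord; apply: le_trans (pocsa_drift k s) _; apply: ler_sum => t _.
  by rewrite ler_wpM2r ?dist_ge0 // le_max lexx orbT.
rewrite -[leLHS]addr0; apply: lerD; last by apply: sumr_ge0.
by rewrite ler_peMl ?dist_ge0 // le_max lexx.
Qed.

Lemma POCSA_uniform_decrease : uniform_decrease C x m (pocsa_rate m eps).
Proof.
move=> k; have [_ e01 _] := hx.
have [Dp <-] := projP ipE Efin (x k) C0 (closed_bigcap_sets Cclosed)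
  (convex_bigcap_sets Cconvex).
apply: le_trans (pocsa_window_decrease k m Dp); apply: lerD.
  by rewrite ler_sqr ?nnegrE ?dist_ge0 // dist_le.
have [i /dist_farthest <-] := farthest_exists C (x k) m_gt0.
have : dist (x k) (C i) ^+ 2 <=
    m%:R * \sum_(t < m) (Num.max 1 (a (k + t)%N) * d (k + t)%N) ^+ 2.
  have := @sqr_sum_le R 'I_m xpredT (fun=> 1)
    (fun t => Num.max 1 (a (k + t)%N) * d (k + t)%N) (fun _ _ => ler01).
  rewrite sumr_const card_ord; under eq_bigr do rewrite mul1r.
  under [X in _ <= _ * X]eq_bigr do rewrite mul1r.
  apply: le_trans; rewrite ler_sqr ?nnegrE ?dist_ge0 //; first exact: pocsa_dist_le.
  by apply: sumr_ge0 => t _; rewrite mulr_ge0 ?dist_ge0 // le_max ler01.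
move=> /(ler_wpM2l (ltW (pocsa_rate_gt0 e01))) /le_trans; apply.
rewrite mulrA mulr_sumr; apply: ler_sum => t _.
rewrite exprMn mulrA ler_wpM2r ?sqr_ge0 //.
exact: pocsa_rate_le.
Qed.

End CyclicDecrease.

(** * Fejer monotone sequences *)

Section FejerMonotone.
Context {R : realType} {E : normedModType R} (D : set E) (x : nat -> E).
Context (fej : fejer_monotone x D).

Lemma fejer_norm_le c k n : D c -> (k <= n)%N -> `|x n - c| <= `|x k - c|.
Proof.
move=> Dc; elim: n => [|n IH]; first by rewrite leqn0 => /eqP ->.
rewrite leq_eqVlt ltnS => /predU1P[->//|/IH]; apply: le_trans; exact: fej.
Qed.

Context (D0 : D !=set0).

Lemma fejer_dist_le k n : (k <= n)%N -> dist (x n) D <= dist (x k) D.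
Proof.
move=> kn; apply: dist_ge => // y Dy.
by rewrite (le_trans (dist_le _ Dy)) ?fejer_norm_le.
Qed.

(** Both iterates are in the ball around a nearly closest point of D whose radius
is the distance of the earlier one. *)
Lemma fejer_close k n : (k <= n)%N -> `|x n - x k| <= 2 * dist (x k) D.
Proof.
move=> kn; apply/ler_addgt0Pr => e e0; have e2 : 0 < e / 2 by lra.
have [y Dy] := dist_approx (x k) D0 e2.
have := fejer_norm_le Dy kn.
have : `|x n - x k| <= `|x n - y| + `|x k - y|.
  by rewrite (distrC (x k)) ler_distD.
lra.
Qed.

Context (ip : {dot E for idfun}) (ipE : forall v : E, `|v| ^+ 2 = ip v v).
Context (Efin : finite_dimensional E) (clD : closed D) (cD : convex_set D).

(** Compare with the projection of 0 onto D, whose norm is [dist 0 D]. The bound is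
[kappa_hat] when D is the intersection of the sets. *)
Lemma fejer_bounded k : `|x k| <= `|x 0%N| + 2 * dist 0 D.
Proof.
have [Dp] := projP ipE Efin 0 D0 clD cD; set p := Defs.proj D 0 in Dp *.
rewrite sub0r normrN => <-; have := fejer_norm_le Dp (leq0n k).
have : `|x k| <= `|x k - p| + `|p| by rewrite -{1}[x k](subrK p) ler_normD.
have : `|x 0%N - p| <= `|x 0%N| + `|p| by rewrite -(normrN p) ler_normD.
lra.
Qed.

Lemma dist_eq0 v : dist v D = 0 -> D v.
Proof.
move=> v0; have [Dp] := projP ipE Efin v D0 clD cD.
by rewrite v0 => /normr0_eq0/subr0_eq ->.
Qed.

Lemma fejer_cvg : (forall e, 0 < e -> exists k, dist (x k) D <= e) ->
  exists2 c, D c & x k @[k --> \oo] --> c.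
Proof.
move=> small.
have cx : cauchy_sequence x.
  move=> e e0; have [|N Ne] := small (e / 4); first by lra.
  exists N => n k Nn Nk; have := fejer_close Nn; have := fejer_close Nk.
  have : `|x n - x k| <= `|x n - x N| + `|x k - x N|.
    by rewrite (distrC (x k)) ler_distD.
  lra.
have [c xc] := cauchy_sequence_cvg ipE Efin cx.
exists c => //; apply: dist_eq0; apply/eqP; rewrite eq_le dist_ge0 andbT.
apply/ler_addgt0Pr => e e0; rewrite add0r; have e2 : 0 < e / 2 by lra.
have [N Ne] := small _ e2.
have /filter_ex[n [Nn nc]] : \forall n \near \oo, (N <= n)%N /\ `|c - x n| < e / 2.
  by apply: filterI; [exists N|move/cvgrPdist_lt: xc; exact].
have := dist_lipschitz c (x n) D0; have := fejer_dist_le Nn; lra.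
Qed.

Lemma fejer_finite k : D (x k) -> finite_convergence x D.
Proof.
move=> Dk; exists k => n kn; split => //; apply/eqP.
rewrite -subr_eq0 -normr_le0 (le_trans (fejer_norm_le Dk kn)) //.
by rewrite subrr normr0.
Qed.

End FejerMonotone.

(** * Rates from scalar recursions and Hoelderian error bounds *)

Section Recursion.
Context {R : realType} (b : nat -> R) (l : nat) (c : R).
Context (b_ge0 : forall k, 0 <= b k).
Context (b_noninc : forall k n, (k <= n)%N -> b n <= b k).
Context (l_gt0 : (0 < l)%N) (c_gt0 : 0 < c).

Let b_divn k : b k <= b (k %/ l * l)%N.
Proof. by apply: b_noninc; exact: leq_divM. Qed.

Lemma onem_le_expRN (t : R) : 1 - t <= expR (- t).
Proof. exact: expR_ge1Dx. Qed.

(** Theta is exp(- c / l), so that theta^l = exp(-c) >= 1 - c is the decrease over l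
steps; the factor exp(c) in M pays for rounding k down to a multiple of l. *)
Lemma linear_recursion : (forall k, b (k + l)%N <= b k * (1 - c)) ->
  exists M theta, [/\ 0 < M, 0 < theta < 1 & forall k, b k <= M * theta ^+ k].
Proof.
move=> rec; have lR : 0 < l%:R :> R by rewrite ltr0n.
pose q := expR (- c); have q0 : 0 < q := expR_gt0 _.
have bq n : b (n * l)%N <= b 0%N * q ^+ n.
  elim: n => [|n IH]; first by rewrite mul0n mulr1.
  rewrite mulSn addnC (le_trans (rec _)) //.
  rewrite (le_trans (ler_wpM2l (b_ge0 _) (onem_le_expRN c))) //.
  by rewrite exprSr mulrA ler_wpM2r // ltW.
pose theta := expR (- (c / l%:R)); have t0 : 0 < theta := expR_gt0 _.
have t1 : theta < 1 by rewrite expR_lt1 oppr_lt0 divr_gt0.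
have tl : theta ^+ l = q.
  by rewrite -expRM_natl mulrN mulrC divfK // gt_eqF.
exists (b 0%N / q + 1), theta; split; last 1 first.
- move=> k; rewrite (le_trans (b_divn k)) // (le_trans (bq _)) //.
  have tk : q ^+ (k %/ l) * q <= theta ^+ k.
    rewrite [in leRHS](divn_eq k l) exprD mulnC exprM tl ler_pM2l ?exprn_gt0 //.
    have kl : (k %% l <= l)%N by rewrite ltnW // ltn_mod.
    by have := ler_wiXn2l (ltW t0) (ltW t1) kl; rewrite tl.
  rewrite (@le_trans _ _ (b 0%N / q * (q ^+ (k %/ l) * q))) //.
    by rewrite (mulrC _ q) mulrA divfK // gt_eqF.
  apply: ler_pM => //; [by rewrite divr_ge0 // ltW| |by rewrite lerDl].
  by rewrite mulr_ge0 ?exprn_ge0 ?ltW.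
- by rewrite ltr_wpDl // divr_ge0 // ltW.
- by rewrite t0.
Qed.

(** From 1 - t <= exp(-t), u = b^q satisfies u_(k+l) <= u_k exp(- c q u_k), and
then 1 / u_(k+l) >= exp(c q u_k) / u_k >= 1 / u_k + c q. So 1 / u grows at least
linearly. *)
Lemma polynomial_recursion q : 0 < q ->
  (forall k, b (k + l)%N <= b k * (1 - c * b k `^ q)) ->
  exists2 M, 0 < M & forall k, (0 < k)%N -> b k <= M * k%:R `^ (- q^-1).
Proof.
move=> q0 rec; have lR : 0 < l%:R :> R by rewrite ltr0n.
have [b0|b0] := eqVneq (b 0%N) 0.
  exists 1 => // k _; rewrite mul1r (le_trans _ (powR_ge0 _ _)) //.
  by rewrite -b0 b_noninc.
have {}b0 : 0 < b 0%N by rewrite lt_neqAle eq_sym b0 b_ge0.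
pose u k := b k `^ q.
have u_rec k : 0 < b k -> 0 < b (k + l)%N -> (u k)^-1 + c * q <= (u (k + l)%N)^-1.
  move=> bk bkl; have uk : 0 < u k by rewrite powR_gt0.
  have ukl : 0 < u (k + l)%N by rewrite powR_gt0.
  have uu : u (k + l)%N <= u k * expR (- (c * u k * q)).
    have -> : u k * expR (- (c * u k * q)) = (b k * expR (- (c * u k))) `^ q.
      by rewrite powRM ?expR_ge0 // -expRM mulNr.
    rewrite ge0_ler_powR ?nnegrE ?mulr_ge0 ?expR_ge0 // ?(ltW q0) //.
    rewrite (le_trans (rec k)) // ler_wpM2l //; exact: onem_le_expRN.
  have le_e : 1 + c * u k * q <= expR (c * u k * q) := expR_ge1Dx _.
  have -> : (u k)^-1 + c * q = (1 + c * u k * q) / u k.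
    by rewrite mulrDl mul1r mulrAC mulfK // gt_eqF.
  rewrite ler_pdivrMr // (le_trans le_e) // ler_pdivlMl //.
  by rewrite -ler_pdivlMr ?expR_gt0 // -expRN.
have u_div n : 0 < b (n * l)%N -> (u 0%N)^-1 + c * q * n%:R <= (u (n * l)%N)^-1.
  elim: n => [|n IH] bn; first by rewrite mulr0 addr0 mul0n.
  have bn' : 0 < b (n * l)%N.
    by rewrite (lt_le_trans bn) // b_noninc // leq_mul2r leqnSn orbT.
  move: bn; rewrite mulSn addnC => bn.
  by rewrite -natr1 mulrDr mulr1 addrA (le_trans _ (u_rec _ bn' bn)) // lerD2r IH.
(* 1 / u_0 + c q n >= A (n + 1) >= A k / l for n = k %/ l *)
pose A := Num.min (u 0%N)^-1 (c * q).
have A0 : 0 < A by rewrite lt_min invr_gt0 powR_gt0 // mulr_gt0.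
have lA0 : 0 < l%:R / A by rewrite divr_gt0.
exists ((l%:R / A) `^ q^-1) => [|k k0]; first by rewrite powR_gt0.
have [bk|bk] := eqVneq (b k) 0; first by rewrite bk mulr_ge0 ?powR_ge0.
have {}bk : 0 < b k by rewrite lt_neqAle eq_sym bk b_ge0.
have kR : 0 < k%:R :> R by rewrite ltr0n.
have bdiv : 0 < b (k %/ l * l)%N := lt_le_trans bk (b_divn k).
have Ak : A * (k%:R / l%:R) <= (u k)^-1.
  have kl : k%:R / l%:R <= (k %/ l)%:R + 1 :> R.
    by rewrite ler_pdivrMr // natr1 -natrM ler_nat mulnC ltnW // mulnC ltn_ceil.
  rewrite (le_trans (ler_wpM2l (ltW A0) kl)) //.
  have uu : (u (k %/ l * l)%N)^-1 <= (u k)^-1.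
    rewrite lef_pV2 ?posrE ?powR_gt0 //.
    by apply: ge0_ler_powR; rewrite ?nnegrE ?b_ge0 ?b_divn ?(ltW q0).
  rewrite (le_trans _ uu) // (le_trans _ (u_div _ bdiv)) //.
  rewrite mulrDr mulr1 addrC; apply: lerD; first by rewrite ge_min lexx.
  by rewrite ler_wpM2r // ge_min lexx orbT.
have uk : u k <= l%:R / A / k%:R.
  have uk0 : 0 < u k by rewrite powR_gt0.
  have -> : l%:R / A / k%:R = (A * (k%:R / l%:R))^-1.
    by rewrite !invfM invrK [RHS]mulrA [RHS]mulrC [RHS]mulrA.
  by rewrite -[leLHS]invrK lef_pV2 // posrE ?invr_gt0 // mulr_gt0 // divr_gt0.
have -> : b k = u k `^ q^-1 by rewrite -powRrM divff ?gt_eqF // powRr1.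
have -> : k%:R `^ (- q^-1) = (k%:R^-1) `^ q^-1 :> R.
  by rewrite -powR_inv1 ?ltW // -powRrM mulN1r.
rewrite -powRM ?invr_ge0 ?(ltW lA0) ?(ltW kR) //.
by apply: ge0_ler_powR; rewrite ?nnegrE ?invr_ge0 ?(ltW q0) ?powR_ge0
  ?mulr_ge0 ?invr_ge0 ?(ltW A0) ?(ltW lR) ?(ltW kR).
Qed.
End Recursion.

Section HoelderRates.
Context {R : realType} {E : normedModType R} {m : nat} (C : 'I_m -> set E).
Context (x : nat -> E) (l : nat) (a : R).
Context (C0 : \bigcap_i C i !=set0) (fej : fejer_monotone x (\bigcap_i C i)).
Context (l_gt0 : (0 < l)%N) (a_gt0 : 0 < a) (dec : uniform_decrease C x l a).

Let b k := dist (x k) (\bigcap_i C i) ^+ 2.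

Let b_ge0 k : 0 <= b k. Proof. exact: sqr_ge0. Qed.

Let b_noninc k n : (k <= n)%N -> b n <= b k.
Proof. by move=> kn; rewrite ler_sqr ?nnegrE ?dist_ge0 // fejer_dist_le. Qed.

(** The error bound gives b_k^(1 / gamma) <= theta^(2 / gamma) maxdist(x_k)^2, so
the decrease a maxdist(x_k)^2 is at least a multiple of b_k^(1 / gamma), which is
b_k times b_k^(1 / gamma - 1). *)
Lemma hoelder_recursion theta gamma : 0 < theta -> 0 < gamma <= 1 ->
  (forall k, dist (x k) (\bigcap_i C i) <= theta * maxdist C (x k) `^ gamma) ->
  exists2 c, 0 < c & forall k, b (k + l)%N <= b k * (1 - c * b k `^ (gamma^-1 - 1)).
Proof.
move=> th0 /andP[g0 g1] eb; have t20 : 0 < theta ^+ 2 by rewrite exprn_gt0.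
have K0 : 0 < (theta ^+ 2) `^ gamma^-1 by rewrite powR_gt0.
exists (a / (theta ^+ 2) `^ gamma^-1) => [|k]; first exact: divr_gt0.
have bD : b k `^ gamma^-1 <= (theta ^+ 2) `^ gamma^-1 * maxdist C (x k) ^+ 2.
  have D0 := maxdist_ge0 C (x k).
  have -> : maxdist C (x k) ^+ 2 = ((maxdist C (x k) `^ gamma) ^+ 2) `^ gamma^-1.
    by rewrite -!powR_mulrn ?powR_ge0 // -!powRrM mulrCA divff ?gt_eqF // mulr1.
  rewrite -powRM ?sqr_ge0 // -exprMn ge0_ler_powR ?nnegrE ?invr_ge0 ?sqr_ge0
    ?(ltW g0) //.
  rewrite /b ler_sqr ?nnegrE ?dist_ge0 ?mulr_ge0 ?powR_ge0 ?(ltW th0) //; exact: eb.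
have bq : b k * b k `^ (gamma^-1 - 1) = b k `^ gamma^-1.
  have [->|bk] := eqVneq (b k) 0; first by rewrite mul0r powR0 // invr_eq0 gt_eqF.
  by rewrite -{1}[b k]powRr1 // -powRD ?bk ?implybT // addrC subrK.
rewrite mulrBr mulr1 mulrCA bq.
have := dec k; rewrite -/(b _) -/(b _).
have : a / (theta ^+ 2) `^ gamma^-1 * b k `^ gamma^-1 <= a * maxdist C (x k) ^+ 2.
  by rewrite -mulrA ler_pM2l // ler_pdivrMl.
lra.
Qed.

Let dist_sqrt k : dist (x k) (\bigcap_i C i) = Num.sqrt (b k).
Proof. by rewrite sqrtr_sqr ger0_norm ?dist_ge0. Qed.

Lemma polynomial_dist_rate c q : 0 < c -> 0 < q ->
  (forall k, b (k + l)%N <= b k * (1 - c * b k `^ q)) ->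
  exists2 M, 0 < M & forall k, (0 < k)%N ->
    dist (x k) (\bigcap_i C i) <= M * k%:R `^ (- (2 * q)^-1).
Proof.
move=> c0 q0 rec.
have [M M0 bM] := polynomial_recursion b_ge0 b_noninc l_gt0 c0 q0 rec.
exists (Num.sqrt M) => [|k k0]; first by rewrite sqrtr_gt0.
have -> : k%:R `^ (- (2 * q)^-1) = Num.sqrt (k%:R `^ (- q^-1)) :> R.
  by rewrite -powR12_sqrt ?powR_ge0 // -powRrM invfM mulNr [2^-1 * _]mulrC.
by rewrite dist_sqrt -sqrtrM ?(ltW M0) // ler_wsqrtr // bM.
Qed.

Lemma linear_dist_rate c : 0 < c -> (forall k, b (k + l)%N <= b k * (1 - c)) ->
  exists M theta, [/\ 0 < M, 0 < theta < 1
    & forall k, dist (x k) (\bigcap_i C i) <= M * theta ^+ k].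
Proof.
move=> c0 rec.
have [M [t [M0 /andP[t0 t1] bM]]] := linear_recursion b_ge0 b_noninc l_gt0 c0 rec.
exists (Num.sqrt M), (Num.sqrt t); split => [||k]; first by rewrite sqrtr_gt0.
  by rewrite sqrtr_gt0 t0 -[ltRHS]sqrtr1 ltr_sqrt.
have -> : Num.sqrt t ^+ k = Num.sqrt (t ^+ k).
  elim: k => [|k IH]; first by rewrite sqrtr1.
  by rewrite exprS IH -sqrtrM ?(ltW t0) // exprS.
by rewrite dist_sqrt -sqrtrM ?(ltW M0) // ler_wsqrtr.
Qed.

Context (ip : {dot E for idfun}) (ipE : forall v : E, `|v| ^+ 2 = ip v v).
Context (Efin : finite_dimensional E).
Context (Cclosed : forall i, closed (C i)) (Cconvex : forall i, convex_set (C i)).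

Definition fejer_ball : set E :=
  [set v | `|v| <= `|x 0%N| + 2 * dist 0 (\bigcap_i C i)].

Lemma bounded_fejer_ball : bounded_set fejer_ball.
Proof.
exists (`|x 0%N| + 2 * dist 0 (\bigcap_i C i)); split; first exact: num_real.
by move=> M /= lM v /= vb; rewrite (le_trans vb) // ltW.
Qed.

Lemma in_fejer_ball k : fejer_ball (x k).
Proof.
apply: (fejer_bounded fej C0 ipE Efin); first exact: closed_bigcap_sets.
exact: convex_bigcap_sets.
Qed.

(** For gamma = 1 the geometric recursion is weakened to the one with exponent
q = 1, as b_k / (b_0 + 1) <= 1, so that one polynomial form covers all cases. *)
Lemma hoelderian_rate : hoelderian_error_bound C ->
  exists2 p : R, 0 < p & exists2 M, 0 < M & forall k, (0 < k)%N ->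
    dist (x k) (\bigcap_i C i) <= M * k%:R `^ (- p).
Proof.
move=> /(_ _ bounded_fejer_ball) [theta [gamma [th0 g01 eb]]].
have [|c c0 rec] := hoelder_recursion th0 g01.
  by move=> k; apply: eb; exact: in_fejer_ball.
have /andP[g0 g1] := g01.
have [g1E|gN1] := eqVneq gamma 1; last first.
  have q0 : 0 < gamma^-1 - 1 by rewrite subr_gt0 invf_gt1 // lt_neqAle gN1.
  exists (2 * (gamma^-1 - 1))^-1; first by rewrite invr_gt0 mulr_gt0.
  exact: polynomial_dist_rate c0 q0 rec.
exists (2 * 1)^-1; first by rewrite invr_gt0 mulr1.
have B0 : 0 < b 0%N + 1 by rewrite ltr_wpDl.
apply: (@polynomial_dist_rate (c / (b 0%N + 1)) 1) => // [|k]; first exact: divr_gt0.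
apply: le_trans (rec k) _; rewrite ler_wpM2l // lerD2l lerN2 powRr1 //.
rewrite g1E invr1 subrr powRr0 mulr1 -mulrA ler_piMr ?(ltW c0) //.
by rewrite ler_pdivrMl // mulr1 (le_trans (b_noninc (leq0n k))) // lerDl.
Qed.

Lemma uniform_hoelderian_rate gamma : uniform_hoelderian_error_bound C gamma ->
  uniform_hoelder_rate C x gamma 1.
Proof.
move=> [g01 /(_ _ bounded_fejer_ball) [theta th0 eb]].
have [|c c0 rec] := hoelder_recursion th0 g01.
  by move=> k; apply: eb; exact: in_fejer_ball.
have /andP[g0 g1] := g01; rewrite /uniform_hoelder_rate.
have [gl1|ge1] := ltP gamma 1.
  have q0 : 0 < gamma^-1 - 1 by rewrite subr_gt0 invf_gt1.
  have [M M0 bM] := polynomial_dist_rate c0 q0 rec.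
  by exists M, 2^-1; split => //; apply/andP; split; lra.
have gE : gamma = 1 by apply/eqP; rewrite eq_le g1.
have [|M [t [M0 t01 bM]]] := linear_dist_rate c0.
  by move=> k; have := rec k; rewrite gE invr1 subrr powRr0 mulr1.
by exists M, t; split.
Qed.

Lemma powR_neg_small (p e : R) : 0 < p -> 0 < e ->
  exists2 k, (0 < k)%N & k%:R `^ (- p) <= e.
Proof.
move=> p0 e0; exists (Num.truncn (e `^ (- p^-1))).+1 => //.
have h : e `^ (- p^-1) <= (Num.truncn (e `^ (- p^-1))).+1%:R.
  by rewrite ltW // truncnS_gt.
set k := _.+1 in h *.
rewrite powRN -[leRHS]invrK lef_pV2 ?posrE ?invr_gt0 ?powR_gt0 ?ltr0n //.
have -> : e^-1 = (e `^ (- p^-1)) `^ p.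
  by rewrite -powRrM mulNr mulVf ?gt_eqF // powR_inv1 // ltW.
by rewrite ge0_ler_powR ?nnegrE ?powR_ge0 // ltW.
Qed.

Lemma hoelderian_cvg : hoelderian_error_bound C ->
  exists2 c, (\bigcap_i C i) c & x k @[k --> \oo] --> c.
Proof.
move=> /hoelderian_rate[p p0 [M M0 xM]].
apply: (fejer_cvg fej C0 ipE Efin); first exact: closed_bigcap_sets.
  exact: convex_bigcap_sets.
move=> e e0; have [k k0 ke] := powR_neg_small p0 (divr_gt0 e0 M0).
by exists k; rewrite (le_trans (xM _ k0)) // mulrC -ler_pdivlMr.
Qed.

Lemma hoelderian_bigO : hoelderian_error_bound C ->
  exists2 p : R, 0 < p & (fun k => dist (x k) (\bigcap_i C i) : R^o)
    =O_\oo (fun k => k%:R `^ (- p) : R^o).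
Proof.
move=> /hoelderian_rate[p p0 [M M0 xM]]; exists p => //.
apply/eqOP; near=> N; near=> k.
rewrite ger0_norm ?dist_ge0 // [X in _ * X]ger0_norm ?powR_ge0 //.
rewrite (le_trans (xM _ _)) //; first by near: k; exists 1%N.
by rewrite ler_wpM2r ?powR_ge0 //; near: N; apply: nbhs_pinfty_ge; exact: num_real.
Unshelve. all: by end_near. Qed.

End HoelderRates.

(** * The inverse smoothing function *)

Section InverseSmoothing.
Context {R : realType} (Phi : R -> R -> R) (kappa : R).
Local Notation phiK := (phi kappa Phi).
Local Notation dom := (ism_dom kappa Phi).
Local Notation leb := (@lebesgue_measure R).
Context (phi_lt : forall s t, 0 <= s -> s < t -> phiK s < phiK t).
Context (phi_small : forall s, 0 < s -> exists2 t, 0 < t & phiK t < s).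

(** The supremum defining the domain need not be attained: a point is in the domain
if and only if phi strictly exceeds it somewhere. *)
Lemma ism_domP s : dom s <-> 0 < s /\ exists2 u, 0 <= u & s < phiK u.
Proof.
split=> [[s0 /ereal_sup_gt[_ [u u0 <-]]]|[s0 [u u0 su]]].
  by rewrite lte_fin => su; split => //; exists u.
by split=> //; apply/ereal_sup_gtP; exists (phiK u)%:E; [exists u|rewrite lte_fin].
Qed.

Lemma ism_dom_between a b s : dom a -> dom b -> a <= s -> s <= b -> dom s.
Proof.
move=> /ism_domP[a0 _] /ism_domP[_ [u u0 bu]] as_ sb; apply/ism_domP.
by split; [exact: lt_le_trans as_|exists u => //; exact: le_lt_trans bu].
Qed.

Local Notation psi := (gen_inv phiK).
Let level s := [set t | 0 <= t /\ s <= phiK t].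

Lemma gen_inv_le s t : 0 <= t -> s <= phiK t -> psi s <= t.
Proof. by move=> t0 st; apply: ge_inf; [exists 0 => r []|]. Qed.

Let level_nonempty s : dom s -> level s !=set0.
Proof. by move=> /ism_domP[_ [u u0 /ltW su]]; exists u. Qed.

(** This is where the right-continuity of phi at 0 is used: phi stays below s on a
neighbourhood of 0. *)
Lemma gen_inv_gt0 s : dom s -> 0 < psi s.
Proof.
move=> ds; have [s0 _] := ds; have [t t0 ts] := phi_small s0.
apply: lt_le_trans t0 _; apply: lb_le_inf; first exact: level_nonempty.
move=> r [r0 sr]; rewrite leNgt; apply/negP => /(phi_lt r0) /lt_trans/(_ ts).
by rewrite ltNge sr.
Qed.

Lemma gen_inv_nondecreasing s t : dom t -> s <= t -> psi s <= psi t.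
Proof.
move=> dt st; apply: lb_le_inf; first exact: level_nonempty.
by move=> r [r0 tr]; apply: gen_inv_le => //; exact: le_trans tr.
Qed.

Local Notation g := (fun s => (psi s)^-1).

Lemma integrand_nonincreasing s t : dom s -> dom t -> s <= t -> g t <= g s.
Proof.
move=> ds dt st; rewrite lef_pV2 ?posrE ?gen_inv_gt0 //.
exact: gen_inv_nondecreasing.
Qed.

Lemma integrand_integrable a b : dom a -> dom b ->
  leb.-integrable `[a, b] (EFin \o g).
Proof.
move=> da db; apply: measurable_bounded_integrable => //.
- by rewrite /= lebesgue_measure_itv /=; case: ifP => //; rewrite -EFinD ltry.
- have [ba|ab] := ltP b a.
    by rewrite set_itv_ge ?bnd_simp -?ltNge //; exact: measurable_fun_set0.
(* Clamping to [a, b] makes the integrand monotone on the whole line. *)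
  pose h s := g (Num.max a (Num.min s b)).
  have clamp s : dom (Num.max a (Num.min s b)).
    apply: (ism_dom_between da db); first by rewrite le_max lexx.
    by rewrite ge_max ab ge_min lexx orbT.
  apply: (@eq_measurable_fun _ _ _ _ _ h).
    move=> s; rewrite inE /= in_itv /= => /andP[as_ sb].
    by rewrite /h (min_l sb) (max_r as_).
  apply: nonincreasing_measurable => // s t st.
  apply: integrand_nonincreasing => //.
  rewrite ge_max; apply/andP; split; first by rewrite le_max lexx.
  by rewrite le_max le_min !ge_min st lexx !orbT.
- exists (g a); split; first exact: num_real.
  move=> M aM s /=; rewrite in_itv /= => /andP[as_ sb].
  have ds := ism_dom_between da db as_ sb.
  rewrite ger0_norm ?invr_ge0 ?(ltW (gen_inv_gt0 ds)) //.
  by rewrite (le_trans (integrand_nonincreasing da ds as_)) // ltW.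
Qed.

Let I a b := \int[leb]_(s in `[a, b]) g s.

Let I_chasles a b c : dom a -> dom c -> a <= b -> b <= c -> I a c = I a b + I b c.
Proof.
move=> da dc ab bc.
have := @Rintegral_itvB R g (BLeft a) (BRight c) b (integrand_integrable da dc).
rewrite !bnd_simp => /(_ ab bc); rewrite -/(I a c) -/(I a b).
rewrite Rintegral_itv_obnd_cbnd; last first.
  apply: integrableS (integrand_integrable da dc) => //.
  by apply: subset_itvr; rewrite bnd_simp.
by rewrite -/(I b c) => <-; rewrite addrC subrK.
Qed.

Lemma integral_bounds a b : dom a -> dom b -> a <= b ->
  g b * (b - a) <= I a b <= g a * (b - a).
Proof.
move=> da db ab.
have len r : \int[leb]_(_ in `[a, b]) r = r * (b - a).
  rewrite Rintegral_cst //= lebesgue_measure_itv /= lte_fin.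
  by move: ab; rewrite le_eqVlt => /predU1P[->|->//]; rewrite ltxx subrr.
have cst_int r : leb.-integrable `[a, b] (EFin \o (fun=> r)).
  apply: measurable_bounded_integrable => //.
    by rewrite /= lebesgue_measure_itv /=; case: ifP => //; rewrite -EFinD ltry.
  exists `|r|; split; first exact: num_real.
  by move=> M rM s _ /=; rewrite ltW.
rewrite -!len; apply/andP; split; apply: le_Rintegral => //;
  try exact: integrand_integrable.
- move=> s /=; rewrite in_itv /= => /andP[as_ sb].
  by apply: integrand_nonincreasing => //; exact: ism_dom_between as_ sb.
- move=> s /=; rewrite in_itv /= => /andP[as_ sb].
  by apply: integrand_nonincreasing => //; exact: ism_dom_between as_ sb.
Qed.

Context (delta : R) (ddelta : dom delta).
Local Notation F := (ism kappa Phi delta).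

Lemma ism_sub a b : dom a -> dom b -> a <= b -> F b = F a + I a b.
Proof.
move=> da db ab; rewrite /ism /integral_from.
have [dla|adl] := leP delta a.
  by rewrite (le_trans dla ab); exact: I_chasles.
have [dlb|bdl] := leP delta b.
  by have := I_chasles da db (ltW adl) dlb; rewrite /I; lra.
by have := I_chasles da ddelta ab (ltW bdl); rewrite /I; lra.
Qed.

Lemma ism_increasing a b : dom a -> dom b -> a < b -> F a < F b.
Proof.
move=> da db ab; rewrite (ism_sub da db (ltW ab)) ltrDl.
have /andP[+ _] := integral_bounds da db (ltW ab); apply: lt_le_trans.
by rewrite mulr_gt0 ?subr_gt0 // invr_gt0 gen_inv_gt0.
Qed.

Lemma ism_nondecreasing a b : dom a -> dom b -> a <= b -> F a <= F b.
Proof.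
by move=> da db; rewrite le_eqVlt => /predU1P[->//|/(ism_increasing da db)/ltW].
Qed.

(** Intermediate value theorem for the integral from a. *)
Lemma ism_range_between a b y : dom a -> dom b -> a <= b -> F a <= y <= F b ->
  ism_range kappa Phi delta y.
Proof.
move=> da db ab /andP[ay yb].
have cont := parameterized_integral_continuous ab (integrand_integrable da db).
have [|c + cE] := IVT (v := y - F a) ab cont.
  rewrite /parameterized_integral set_itv1 Rintegral_set1 -/(I a b).
  have := ism_sub da db ab => E1.
  rewrite min_l ?max_r; lra.
rewrite in_itv /= => /andP[ac cb]; have dc := ism_dom_between da db ac cb.
exists c => //; rewrite (ism_sub da dc ac) [I a c]cE; lra.
Qed.

Lemma ism_le_inv b y : dom b -> ism_range kappa Phi delta y -> F b <= y ->
  b <= ism_inv kappa Phi delta y.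
Proof.
move=> db yr by_; set z := ism_inv kappa Phi delta y.
have dz : dom z.
  by apply: (surjpinv_image_sub (B := F @` dom) (@subset_refl _ _)); exists y.
have zE : F z = y by apply: pinvK; rewrite inE.
by rewrite leNgt; apply/negP => /(ism_increasing dz db); rewrite zE ltNge by_.
Qed.

(** The integrand is nonincreasing, so the primitive grows from p to q by at least
(q - p) / gen_inv phi q >= a D2 / gen_inv phi q; and gen_inv phi q <= D2 because
q <= phi D2. *)
Lemma ism_step p q a D2 : dom p -> dom q -> 0 <= a -> 0 <= D2 ->
  p + a * D2 <= q -> q <= phiK D2 -> F p + a <= F q.
Proof.
move=> dp dq a0 D0 pq qD; have pq' : p <= q by have := mulr_ge0 a0 D0; lra.
rewrite (ism_sub dp dq pq') lerD2l.
have /andP[+ _] := integral_bounds dp dq pq'; apply: le_trans.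
have psi0 := gen_inv_gt0 dq; rewrite ler_pdivlMl //.
have := ler_wpM2l a0 (gen_inv_le D0 qD); lra.
Qed.

End InverseSmoothing.

(** * Rates from strict consistent error bounds *)

Section SmoothingRate.
Context {R : realType} {E : normedModType R} (ip : {dot E for idfun}).
Context (ipE : forall v : E, `|v| ^+ 2 = ip v v) (Efin : finite_dimensional E).
Context {m : nat} (C : 'I_m -> set E).
Context (Cclosed : forall i, closed (C i)) (Cconvex : forall i, convex_set (C i)).
Context (C0 : \bigcap_i C i !=set0) (x : nat -> E).
Context (fej : fejer_monotone x (\bigcap_i C i)).
Context (infinite : forall k, ~ (\bigcap_i C i) (x k)).
Context (Phi : R -> R -> R) (PhiP : strict_consistent_error_bound C Phi).

Local Notation D := (\bigcap_i C i).
Local Notation kappa := (kappa_hat C x).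

Let clD : closed D. Proof. exact: closed_bigcap_sets. Qed.
Let cD : convex_set D. Proof. exact: convex_bigcap_sets. Qed.

Lemma dist_gt0 k : 0 < dist (x k) D.
Proof.
rewrite lt_neqAle dist_ge0 andbT eq_sym; apply/eqP => xk0.
by apply: (@infinite k); exact: (dist_eq0 C0 ipE Efin clD cD).
Qed.

(** If [kappa_hat] were 0, then x_0 = 0 would be in the intersection. *)
Lemma kappa_hat_gt0 : 0 < kappa.
Proof.
have d0 := dist_ge0 (0 : E) D; have x0 := normr_ge0 (x 0%N).
have := dist_gt0 0; have := dist_lipschitz (x 0%N) 0 C0; rewrite subr0 /kappa_hat; lra.
Qed.

Let Phi_ge0 a : 0 <= a -> 0 <= Phi a kappa.
Proof. by have [[+ _ _ _] _] := PhiP => Phi0 a0; exact: Phi0 (ltW kappa_hat_gt0). Qed.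

Lemma phi_strictly_increasing s t : 0 <= s -> s < t ->
  phi kappa Phi s < phi kappa Phi t.
Proof.
move=> s0 st; have [_ /(_ _ kappa_hat_gt0) inc] := PhiP.
rewrite /phi ltr_sqr ?nnegrE ?Phi_ge0 ?sqrtr_ge0 //; apply: inc; first exact: sqrtr_ge0.
by rewrite ltr_sqrt // (le_lt_trans s0).
Qed.

Lemma phi_small s : 0 < s -> exists2 t, 0 < t & phi kappa Phi t < s.
Proof.
move=> s0; have [[_ _ /(_ _ (ltW kappa_hat_gt0)) [_ + Phi0] _] _] := PhiP.
rewrite Phi0 => /cvgrPdist_lt /(_ (Num.sqrt s)); rewrite sqrtr_gt0 => /(_ s0) nr.
have /filter_ex[a [a0 aP]] :
    \forall a \near 0^'+, 0 < a /\ `|0 - Phi a kappa| < Num.sqrt s.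
  by apply: filterI => //; exact: nbhs_right_gt.
exists (a ^+ 2); first by rewrite exprn_gt0.
rewrite /phi sqrtr_sqr (gtr0_norm a0) -[ltRHS]sqr_sqrtr ?(ltW s0) //.
rewrite ltr_sqr ?nnegrE ?sqrtr_ge0 ?Phi_ge0 ?(ltW a0) //.
by move: aP; rewrite sub0r normrN ger0_norm // Phi_ge0 ?(ltW a0).
Qed.

(** The error bound at x_k involves |x_k|, which is at most [kappa_hat]. *)
Lemma sqr_dist_le_phi k : dist (x k) D ^+ 2 <= phi kappa Phi (maxdist C (x k) ^+ 2).
Proof.
have [[_ eb _ mono] _] := PhiP.
rewrite /phi sqrtr_sqr ger0_norm ?maxdist_ge0 //.
rewrite ler_sqr ?nnegrE ?dist_ge0 ?Phi_ge0 ?maxdist_ge0 //.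
rewrite (le_trans (eb _)) // mono ?maxdist_ge0 //.
exact: (fejer_bounded fej C0 ipE Efin clD cD).
Qed.

Lemma sqr_dist_dom k : ism_dom kappa Phi (dist (x k) D ^+ 2).
Proof.
apply/ism_domP; split; first by rewrite exprn_gt0 // dist_gt0.
exists (maxdist C (x k) ^+ 2 + 1); first by rewrite addr_ge0 ?sqr_ge0.
rewrite (le_lt_trans (sqr_dist_le_phi k)) // phi_strictly_increasing ?sqr_ge0 //.
by rewrite ltrDl.
Qed.

(** The case l = 1 is for methods that see a farthest set at each step, and l = m
for cyclic ones, where only the iterates at multiples of m are compared. Any s
between 0 and the accumulated decrease is allowed, because the value at b_0 minus s
then stays between the values at b_k and b_0, hence in the range. *)
Lemma smoothing_rate_of_decrease delta l (w : nat -> R) n s k :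
  ism_dom kappa Phi delta -> (forall i, 0 <= w i) ->
  (forall i, dist (x (i.+1 * l)%N) D ^+ 2 + w i * maxdist C (x (i * l)%N) ^+ 2
    <= dist (x (i * l)%N) D ^+ 2) ->
  0 <= s -> s <= \sum_(0 <= i < n) w i -> (n * l <= k)%N ->
  smoothing_rate C x Phi delta s k.
Proof.
move=> ddelta w0 dec s0 sw nk; pose F := ism kappa Phi delta.
have telescope i : F (dist (x (i * l)%N) D ^+ 2) + \sum_(0 <= j < i) w j
    <= F (dist (x 0%N) D ^+ 2).
  elim: i => [|i]; first by rewrite mul0n big_geq // addr0.
  rewrite big_nat_recr //=; apply: le_trans; rewrite addrA addrAC lerD2r.
  apply: (ism_step phi_strictly_increasing phi_small ddelta _ _ _ _ (dec i)) => //.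
  - exact: sqr_dist_dom.
  - exact: sqr_dist_dom.
  - exact: sqr_ge0.
  - exact: sqr_dist_le_phi.
have sq_le i j : (i <= j)%N -> dist (x j) D ^+ 2 <= dist (x i) D ^+ 2.
  by move=> ij; rewrite ler_sqr ?nnegrE ?dist_ge0 // fejer_dist_le.
have Fk : F (dist (x k) D ^+ 2) <= F (dist (x 0%N) D ^+ 2) - s.
  have := ism_nondecreasing phi_strictly_increasing phi_small ddelta
    (sqr_dist_dom k) (sqr_dist_dom (n * l)) (sq_le _ _ nk).
  by have := telescope n; rewrite -/F; lra.
have y_range : ism_range kappa Phi delta (F (dist (x 0%N) D ^+ 2) - s).
  apply: (ism_range_between phi_strictly_increasing phi_small ddelta
    (sqr_dist_dom k) (sqr_dist_dom 0)); first exact: sq_le.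
  by rewrite Fk gerBl.
split => //; first exact: sqr_dist_dom.
rewrite -[leLHS]ger0_norm ?dist_ge0 // -sqrtr_sqr ler_wsqrtr //.
exact: (ism_le_inv phi_strictly_increasing phi_small ddelta (sqr_dist_dom k)
  y_range Fk).
Qed.

End SmoothingRate.

(** * Conclusion *)

Lemma constant_series_pinfty (R : realType) (a : R) : 0 < a ->
  (\sum_(0 <= k <oo) a%:E = +oo)%E.
Proof.
move=> a0; apply/eqyP => A A0; pose n := (Num.truncn (A / a)).+1.
have Aa : A <= a *+ n.
  by rewrite -mulr_natr mulrC -ler_pdivrMr // ltW // truncnS_gt.
apply: (@le_trans _ _ (a *+ n)%:E); first by rewrite lee_fin.
have := @nneseries_lim_ge R (fun=> a%:E) xpredT 0 n (fun _ _ _ => ltW a0).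
by rewrite sumEFin big_const_nat subn0 iter_addr_0.
Qed.

Theorem theorem4p13 (R : realType) (E : normedModType R)
    (Efin : finite_dimensional E) (Eip : norm_from_inner_product E)
    (m : nat) (m_gt0 : (0 < m)%N) (C : 'I_m -> set E)
    (Cclosed : forall i, closed (C i)) (Cconvex : forall i, convex_set (C i))
    (C0 : \bigcap_i C i !=set0)
    (alpha lam : nat -> 'I_m -> R) (x : nat -> E)
    (hx : [\/ MPA C alpha lam x, exists eps, POCSA C eps alpha lam x,
              exists lambda, MM C lambda alpha lam x
            | exists f, AWPA C f alpha lam x]) :
  [/\
  (* (i), conditions (1) and (2) *)
    fejer_monotone x (\bigcap_i C i),
    sufficient_decrease C x,
  (* (i), rate from a strict consistent error bound function *)
    forall Phi : R -> R -> R, strict_consistent_error_bound C Phi ->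
      finite_convergence x (\bigcap_i C i) \/
      0 < kappa_hat C x /\
      forall delta, ism_dom (kappa_hat C x) Phi delta ->
        ([\/ MPA C alpha lam x, exists lambda, MM C lambda alpha lam x
           | exists f, AWPA C f alpha lam x] ->
          exists2 mk : nat -> 'I_m, forall k, farthest C (x k) (mk k) &
            forall k, (2 <= k)%N ->
              smoothing_rate C x Phi delta
                (\sum_(0 <= i < k.-1) mu alpha lam i (mk i)) k) /\
        (forall eps, POCSA C eps alpha lam x ->
          let c := Num.min (eps ^+ 2 / m%:R) (eps ^+ 2 / ((2 - eps) ^+ 2 * m%:R)) in
          forall k, (2 * m <= k)%N ->
            smoothing_rate C x Phi delta
              (c * (k%:R - m%:R - (k %% m)%N%:R) / m%:R) k)
  (* (ii) *)
  & (hoelderian_error_bound C ->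
      (exists2 c, (\bigcap_i C i) c & x k @[k --> \oo] --> c) /\
      exists2 p : R, 0 < p &
        (fun k => dist (x k) (\bigcap_i C i) : R^o)
          =O_\oo (fun k => k%:R `^ (- p) : R^o)) /\
    forall gamma, uniform_hoelderian_error_bound C gamma ->
      uniform_hoelder_rate C x gamma (2 * m) /\
      ([\/ MPA C alpha lam x, MDPA C alpha lam x
         | exists f, AWPA C f alpha lam x] ->
        uniform_hoelder_rate C x gamma 2)].
Proof.
have [ip ipE] := Eip.
have hp : projection_algorithm C alpha lam x.
  by case: hx => [[]|[? []]|[? []]|[? []]].
have fej := projection_algorithm_fejer ipE Efin Cclosed Cconvex hp m_gt0.
have [l [a [l_gt0 a_gt0 dec]]] :
    exists l a, [/\ (0 < l)%N, 0 < a & uniform_decrease C x l a].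
  case: hx => [h|[eps h]|[lambda h]|[f h]].
  - have [a] := MPA_uniform_decrease ipE Efin m_gt0 Cclosed Cconvex C0 h.
    by exists 1%N, a.
  - exists m, (pocsa_rate m eps); split => //.
      by have [_ e01 _] := h; exact: pocsa_rate_gt0.
    exact: (POCSA_uniform_decrease ipE Efin m_gt0 Cclosed Cconvex C0 h).
  - have [a] := MM_uniform_decrease ipE Efin Cclosed Cconvex C0 h.
    by exists 1%N, a.
  - have [a] := AWPA_uniform_decrease ipE Efin m_gt0 Cclosed Cconvex C0 h.
    by exists 1%N, a.
split => //.
- exists l, (fun=> a); split => [//|_||k]; [exact: ltW|exact: constant_series_pinfty|].
  by rewrite bigmax_sqr_dist; exact: dec.
- move=> Phi PhiP.
  have [[k xk]|/forallNP infinite] := pselect (exists k, (\bigcap_i C i) (x k)).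
    by left; exact: (@fejer_finite _ _ _ _ fej k).
  right; split; first exact: (kappa_hat_gt0 ipE Efin Cclosed Cconvex C0 infinite).
  move=> delta ddelta.
  have rate := smoothing_rate_of_decrease ipE Efin Cclosed Cconvex C0 fej infinite
    PhiP ddelta.
  split=> [_|eps hpo c k mk].
    have [mk mkP] := choice (fun k => farthest_exists C (x k) m_gt0).
    exists mk => // k k2.
    have mu0 i := mu_ge0 hp i (mk i).
    (* The sum stops one step before k, so the iterate k - 1 suffices. *)
    apply: (rate 1%N _ k.-1 _ k mu0) => //; last by rewrite muln1 leq_pred.
    - move=> i; rewrite !muln1 -(dist_farthest (mkP i)).
      exact: step_dist_le.
    - exact: sumr_ge0.
  have mR : 0 < m%:R :> R by rewrite ltr0n.
  have c0 : 0 < c by have [_ e01 _] := hpo; exact: pocsa_rate_gt0.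
  (* one cycle less than the k %/ m complete ones *)
  have cE : c * (k%:R - m%:R - (k %% m)%N%:R) / m%:R = c * ((k %/ m)%:R - 1).
    rewrite {1}(divn_eq k m) natrD natrM; field; exact: lt0r_neq0.
  have km : (1 <= k %/ m)%N by rewrite divn_gt0 // (leq_trans _ mk) // leq_pmull.
  apply: (rate m (fun=> c) (k %/ m)%N _ k) => [_|i|||].
  - exact: ltW.
  - rewrite mulSn addnC.
    exact: (POCSA_uniform_decrease ipE Efin m_gt0 Cclosed Cconvex C0 hpo).
  - by rewrite cE mulr_ge0 ?(ltW c0) // subr_ge0 ler1n.
  - rewrite cE big_const_nat subn0 iter_addr_0 -[leRHS]mulr_natr ler_wpM2l ?(ltW c0) //.
    by rewrite gerBl.
  - exact: leq_divM.
split=> [hH|gamma hU].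
  split.
    exact: (hoelderian_cvg C0 fej l_gt0 a_gt0 dec ipE Efin Cclosed Cconvex hH).
  exact: (hoelderian_bigO C0 fej l_gt0 a_gt0 dec ipE Efin Cclosed Cconvex hH).
have [M [th [M0 th01 bd]]] := uniform_hoelderian_rate C0 fej l_gt0 a_gt0 dec
  ipE Efin Cclosed Cconvex hU.
split=> [|_]; exists M, th; split => // k kk; apply: bd; apply: leq_trans kk => //.
by rewrite muln_gt0.
Qed.
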